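(* For $z=x+\mathrm{i}y\in\mathbb{C}$ and integers $k,j\ge0$, writing $L_{kj}=L_{kj}(z)$ and taking $L_{-1,j}=L_{k,-1}=0$, $$zL_{kj}=\frac{k-1}{2k+1}L_{k-1,j}+\frac{k+2}{2k+1}L_{k+1,j}+\mathrm{i}\left(\frac{j}{2j+1}L_{k,j-1}+\frac{j+1}{2j+1}L_{k,j+1}\right)+F_{kj}^{(1)}(z)$$ and $$zL_{kj}=\frac{k}{2k+1}L_{k-1,j}+\frac{k+1}{2k+1}L_{k+1,j}+\mathrm{i}\left(\frac{j-1}{2j+1}L_{k,j-1}+\frac{j+2}{2j+1}L_{k,j+1}\right)+F_{kj}^{(2)}(z),$$ where $$F_{0j}^{(1)}(z)=\mathrm{i}\,\frac{M_{j+1}(z-1)+M_{j+1}(z+1)-M_{j-1}(z-1)-M_{j-1}(z+1)}{2j+1}+\mu_j(z-1)+\mu_j(z+1),$$ $$F_{10}^{(1)}(z)=-\tfrac43,\qquad F_{kj}^{(1)}(z)=0\ \text{ for } k\neq0 \text{ and } (k,j)\neq(1,0),$$ $$F_{k0}^{(2)}(z)=\frac{L_{k+1}(z-\mathrm{i})+L_{k+1}(z+\mathrm{i})-L_{k-1}(z-\mathrm{i})-L_{k-1}(z+\mathrm{i})}{2k+1}+\lambda_k(z-\mathrm{i})+\lambda_k(z+\mathrm{i})+\beta_{k0}(z),$$ $$F_{01}^{(2)}(z)=-\tfrac{4\mathrm{i}}3+\beta_{01}(z),\qquad F_{kj}^{(2)}(z)=\beta_{kj}(z)\ \text{ for } j\ne0\text{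 and }(k,j)\ne(0,1),$$ and $$\beta_{kj}(z)=2\mathrm{i}\pi\,C_{j+1}^{(-1/2)}(y)\begin{cases}C_{k+2}^{(-3/2)}(x)/3-\delta_{k0}x+\delta_{k1}/3&z\in\Omega,\\-2x\delta_{k0}+2\delta_{k1}/3&x<-1\text{ and }-1<y<1,\\0&\text{otherwise.}\end{cases}$$
   Context: Conventions: $\log$ is the principal complex logarithm with $\arg\in(-\pi,\pi]$; expressions $w\log w$ are read as $0$ at $w=0$. $P_k$ is the $k$-th Legendre polynomial, $\Omega=\{(x,y):-1\le x,y\le1\}$, identified with a subset of $\mathbb{C}$ via $(x,y)\mapsto x+\mathrm{i}y$. $L_{kj}(z)=\iint_\Omega \log(z-(s+\mathrm{i}t))P_k(s)P_j(t)\,ds\,dt$ for $k,j\ge0$. One-dimensional integrals: $L_k(z)=\int_{-1}^1\log(z-t)P_k(t)\,dt$ and $M_k(z)=\int_{-1}^1\log(z-\mathrm{i}t)P_k(t)\,dt$ for $k\ge0$, with $L_{-1}=M_{-1}=0$. Ultraspherical polynomials: $C_0^{(-1/2)}(x)=1$, $C_1^{(-1/2)}(x)=-x$, $C_n^{(-1/2)}(x)=\frac{(1-x^2)C_{n-2}^{(3/2)}(x)}{n(n-1)}$ for $n\ge2$, with $C_m^{(3/2)}$ the standard Gegenbauer polynomials; $C_n^{(-3/2)}(x)$ is the coefficient of $r^n$ in the power series of $(1-2xr+r^2)^{3/2}$. $\lambda_0(z)=(z-1)\log(z-1)+(z+1)\log(z+1)$, $\lambda_1(z)=-2/3$, $\lambda_k(z)=0$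 for $k\ge2$. For $z=x+\mathrm{i}y$: $\log_-z=\log|z|-\mathrm{i}\pi$ if $y=0$ and $x<0$, and $\log_-z=\log z$ otherwise. $\mu_k(z)=m_k(z)-n_k(z)$ where $m_0(z)=(z-\mathrm{i})\log(z-\mathrm{i})+(z+\mathrm{i})\log_-(z+\mathrm{i})$, $m_1(z)=-2\mathrm{i}/3$, $m_k(z)=0$ for $k\ge2$, and $n_k(z)=2\mathrm{i}\pi x\,C_{k+1}^{(-1/2)}(y)$ if $x<0$ and $-1<y<1$, $n_k(z)=0$ otherwise.
   Formalization: For j=0 the second recurrence is not claimed when y=1, -1≤x<1, nor when y=-1, x<-1, k≤1: β_{k0} is wrong there (at z=i, k=j=0 the sides differ by iπ), except at isolated zeros of C_{k+2}^{(-3/2)}(x), k≥2, on y=1, which are also excluded. *)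

(* Defs.v *)
From HB Require Import structures.
From mathcomp Require Import all_boot all_order all_algebra.
From mathcomp Require Import complex.
From mathcomp Require Import all_classical all_reals all_analysis.

Set Implicit Arguments.
Unset Strict Implicit.
Unset Printing Implicit Defensive.

Import Order.TTheory GRing.Theory Num.Theory.
Import numFieldNormedType.Exports.

Local Open Scope classical_set_scope.
Local Open Scope ring_scope.
Local Open Scope complex_scope.

Section Definitions.
Variable R : realType.
Implicit Types (z w : R[i]) (x y : R) (k j n : nat).

Local Notation Re := (@complex.Re R).
Local Notation Im := (@complex.Im R).

(* arg z lies in ]-pi, pi]; the value at z = 0 is never used, since log z only
   occurs under an integral or multiplied by z. *)
Definition carg z : R :=
  let t := acos (Re z / Num.sqrt (Re z ^+ 2 + Im z ^+ 2)) in
  if 0 <= Im z then t else - t.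

Definition clog z : R[i] :=
  ln (Num.sqrt (Re z ^+ 2 + Im z ^+ 2)) +i* carg z.

Definition clog_minus z : R[i] :=
  if (Im z == 0) && (Re z < 0) then
    ln (Num.sqrt (Re z ^+ 2 + Im z ^+ 2)) +i* (- pi)
  else clog z.

Definition cintegral d (T : measurableType d) (mu : {measure set T -> \bar R})
    (D : set T) (f : T -> R[i]) : R[i] :=
  (\int[mu]_(t in D) Re (f t)) +i* (\int[mu]_(t in D) Im (f t)).

(* Rodrigues' formula. *)
Definition legendre k : {poly R} :=
  ((2 ^ k * k`!)%:R)^-1 *: (('X^2 - 1) ^+ k)^`(k).

(* Coefficient of r ^ n in the Taylor expansion at r = 0 of
   (1 - 2 x r + r ^ 2) ^ (- l). *)
Definition ultraspherical (l : R) n x : R :=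
  derive1n n (fun r : R => (1 - 2 * x * r + r ^+ 2) `^ (- l)) 0 / n`!%:R.

Definition ultraspherical_mhalf n x : R :=
  match n with
  | 0%N => 1
  | 1%N => - x
  | m.+2 => (1 - x ^+ 2) * ultraspherical (3 / 2) m x / (m.+2 * m.+1)%:R
  end.

Definition Omega : set (R * R) := `[-1, 1] `*` `[-1, 1].

Definition Ldouble k j z : R[i] :=
  cintegral (lebesgue_measure \x lebesgue_measure)%E Omega
    (fun p : R * R =>
       clog (z - (p.1 +i* p.2)) * ((legendre k).[p.1] * (legendre j).[p.2])%:C).

Definition Lsingle k z : R[i] :=
  cintegral lebesgue_measure `[-1, 1]
    (fun t : R => clog (z - t%:C) * ((legendre k).[t])%:C).

Definition Msingle k z : R[i] :=
  cintegral lebesgue_measure `[-1, 1]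
    (fun t : R => clog (z - 'i%C * t%:C) * ((legendre k).[t])%:C).

(* f (k - 1), with f (-1) = 0. *)
Definition pred_term (f : nat -> R[i]) k : R[i] :=
  if k is k'.+1 then f k' else 0.

Definition lambda k z : R[i] :=
  match k with
  | 0%N => (z - 1) * clog (z - 1) + (z + 1) * clog (z + 1)
  | 1%N => - (2 / 3)
  | _ => 0
  end.

Definition mu_m k z : R[i] :=
  match k with
  | 0%N => (z - 'i%C) * clog (z - 'i%C) + (z + 'i%C) * clog_minus (z + 'i%C)
  | 1%N => - (2 * 'i%C / 3)
  | _ => 0
  end.

Definition mu_n k z : R[i] :=
  let x := Re z in let y := Im z in
  if (x < 0) && (-1 < y < 1) then
    2 * 'i%C * (pi * x * ultraspherical_mhalf k.+1 y)%:C
  else 0.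

Definition mu k z : R[i] := mu_m k z - mu_n k z.

Definition beta k j z : R[i] :=
  let x := Re z in let y := Im z in
  2 * 'i%C * (pi * ultraspherical_mhalf j.+1 y)%:C *
  (if (x, y) \in Omega then
     ultraspherical (- (3 / 2)) k.+2 x / 3
       - (k == 0%N)%:R * x + (k == 1%N)%:R / 3
   else if (x < -1) && (-1 < y < 1) then
     - (2 * x * (k == 0%N)%:R) + 2 * (k == 1%N)%:R / 3
   else 0)%:C.

Definition F1 k j z : R[i] :=
  if k == 0%N then
    'i%C * ((Msingle j.+1 (z - 1) + Msingle j.+1 (z + 1)
           - pred_term (Msingle ^~ (z - 1)) j
           - pred_term (Msingle ^~ (z + 1)) j) / (2 * j%:R + 1))
    + mu j (z - 1) + mu j (z + 1)
  else if (k == 1%N) && (j == 0%N) then - (4 / 3)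
  else 0.

Definition F2 k j z : R[i] :=
  if j == 0%N then
    (Lsingle k.+1 (z - 'i%C) + Lsingle k.+1 (z + 'i%C)
     - pred_term (Lsingle ^~ (z - 'i%C)) k
     - pred_term (Lsingle ^~ (z + 'i%C)) k) / (2 * k%:R + 1)
    + lambda k (z - 'i%C) + lambda k (z + 'i%C) + beta k 0 z
  else if (k == 0%N) && (j == 1%N) then - (4 * 'i%C / 3) + beta 0 1 z
  else beta k j z.

(* The points where beta is off by a boundary convention, so that the second
   recurrence fails; this only happens for j = 0.  Every other term of that
   recurrence is the limit of its values at x + iy' as y' decreases to y
   (with arg in ]-pi, pi], clog on its cut is the limit from above), but beta is
   not at these points: for y = 1 and -1 <= x < 1, z is in Omega whereas the limit
   is 0; for y = -1 and x < -1, beta is 0 whereas the limit is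
   2 i pi (-2 x delta_k0 + 2 delta_k1 / 3).  For instance the two sides differ by
   i pi at z = i, k = j = 0. *)
Definition exceptional k j z : bool :=
  (j == 0%N) && (((Im z == 1) && (-1 <= Re z < 1))
                 || [&& (k < 2)%N, Im z == -1 & Re z < -1]).

End Definitions.

(* Main.v *)
Require Import Defs.
From mathcomp Require Import all_boot all_order all_algebra.
From mathcomp Require Import ring lra.
From mathcomp Require Import complex.
From mathcomp Require Import all_classical all_reals all_analysis.
From mathcomp Require Import measurable_realfun.

(** Put [u = z - (s + i t)].  Substituting [z = u + s + i t] under the double
    integral and expanding [s P_k(s)] and [t P_j(t)] by the three-term recurrence
    of the Legendre polynomials leaves one new integral, that of
    [u log u P_k(s) P_j(t)] ([log_moment2_mul_z]).  Both recurrences evaluate it,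
    by integrating by parts inside an iterated integral: in [s] for the first
    ([zlog_moment2_F1]), in [t] for the second ([zlog_moment2_F2]).  What makes
    this productive is that [u log u] has derivative [log u + 1], and that [P_k] is
    the derivative of [(P_(k+1) - P_(k-1)) / (2k+1)], which vanishes at both ends
    of [[-1, 1]] when [k > 0].

    Along a horizontal segment [u log u] is continuous, even when the segment lies
    on the branch cut, so that only boundary terms for [k = 0] and an integral of
    the primitive for [k = 1] appear; the boundary terms are integrals of [w log w]
    over the vertical segments centred at [z - 1] and [z + 1].

    Along a vertical segment [u log u] jumps by [2 i pi Re u] where it crosses the
    cut, and this contributes the value of the primitive at the crossing point
    ([zlog_by_parts_v]); if an end of the segment lies on the cut, the value to take
    there is the limit along the segment, which is where [clog_minus] comes from.
    In the second recurrence these jumps are integrated in [s]; each of them is a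
    multiple of [max (s - x) 0], so that their total is governed by the integral of
    [max (s - x) 0 * P_k(s)], a second primitive of [P_k] at [x]
    ([ramp_moment_legendre]).  The ultraspherical polynomials of the statement are
    these primitives in disguise: they satisfy the same three-term recurrences, and
    [C_n^(3/2)] is the derivative of [P_(n+1)].  The excluded points are those where
    the coefficient of the second primitive in [beta] is not the total jump.

    The analytic work is along one line.  If one coordinate [c] is fixed and the
    other one [v] varies, the real and imaginary parts of [u log u] are, in one
    order or the other and away from the cut, [v ln |u| + c a] and [c ln |u| - v a],
    where [a] is [atan (v / c)] up to a constant; their derivatives in [v] are
    [ln |u| + 1] and [- a].  Division by zero being zero, these formulas persist for
    [c = 0], except that the derivatives may fail to exist at [v = 0].  A form of the
    fundamental theorem of calculus that tolerates one such point
    ([Rintegral_FTC_except]) therefore covers all cases at once.  Integrability in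
    one and two variables follows from that of [ln |t|], since [| ln |u| |] is at
    most [| ln |a| | + | ln |b| | + 1 + a^2 + b^2] for [u = a + i b]. *)

Set Implicit Arguments.
Unset Strict Implicit.
Unset Printing Implicit Defensive.

Import Order.TTheory GRing.Theory Num.Theory.
Import numFieldNormedType.Exports.

Local Open Scope classical_set_scope.
Local Open Scope ring_scope.
Local Open Scope complex_scope.

(** * Legendre polynomials and their iterated primitives *)

Section LegendreAlgebra.
Variable R : realType.
Local Notation P := (legendre R).
Local Notation W := ('X^2 - 1 : {poly R}).

Lemma derivnXM n (p : {poly R}) :
  ('X * p)^`(n.+1) = 'X * p^`(n.+1) + p^`(n) *+ n.+1.
Proof.
elim: n => [|n IH]; first by rewrite derivn1 derivn0 derivM derivX mul1r addrC mulr1n.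
by rewrite derivnS IH derivD derivM derivX mul1r derivMn -!derivnS !mulrS; ring.
Qed.

Let c k : R := ((2 ^ k * k`!)%:R)^-1.

Lemma rodrigues_constS k : c k = c k.+1 * 2 * k.+1%:R.
Proof.
rewrite /c expnS factS !natrM; field.
by rewrite natrX !pnatr_eq0 expf_eq0 pnatr_eq0 -lt0n fact_gt0 /= andbF
  (_ : (1 + k%:R != 0 :> R)) // nat1r pnatr_eq0.
Qed.

Lemma deriv_quad_exp k : (W ^+ k.+1)^`() = (2 * k.+1%:R) *: ('X * W ^+ k).
Proof.
rewrite deriv_exp derivB derivC derivXn subr0 /= -mul_polyC !polyCM !polyCMn polyC1 -mulr_natr.
by rewrite -mulr_natr; ring.
Qed.

(** One of the [k + 1] derivatives in Rodrigues' formula is spent on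
    [W^(k+1)], whose derivative is [2 (k+1) X W^k]. *)
Lemma legendre_succ_Rodrigues k : P k.+1 = c k *: ('X * W ^+ k)^`(k).
Proof.
rewrite /legendre derivSn deriv_quad_exp derivnZ scalerA -/(c k.+1) (rodrigues_constS k).
by congr (_ *: _); ring.
Qed.

Lemma deriv_legendre_succ k : (P k.+1)^`() = P k *+ k.+1 + 'X * (P k)^`().
Proof.
rewrite legendre_succ_Rodrigues derivZ -derivnS derivnXM /legendre -/(c k) derivZ -derivnS.
by rewrite scalerDr scalerMnr scalerAr addrC.
Qed.

(** Two derivatives of [W^(k+2)] give a combination of [W^(k+1)] and [W^k],
    because [X^2 = W + 1]. *)
Lemma deriv_legendre_diff k : (P k.+2)^`() = P k.+1 *+ (2 * k).+3 + (P k)^`().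
Proof.
rewrite legendre_succ_Rodrigues derivZ -derivnS derivSn derivM derivX mul1r deriv_quad_exp.
have -> : W ^+ k.+1 + 'X * ((2 * k.+1%:R) *: ('X * W ^+ k)) =
    W ^+ k.+1 *+ (2 * k).+3 + (2 * k.+1%:R) *: W ^+ k.
  rewrite -!mul_polyC !polyCM !polyCMn polyC1 exprS -mulr_natr.
  rewrite [(2 * k).+3%:R](_ : _ = 2 * k%:R + 3 :> {poly R});
    last by rewrite -(addn3 (2 * k)) natrD natrM.
  ring.
rewrite derivnD derivnMn derivnZ scalerDr scalerA scalerMnr.
by rewrite mulrA -rodrigues_constS derivnS /legendre derivZ.
Qed.

Lemma Xderiv_legendre_succ k : 'X * (P k.+1)^`() = P k.+1 *+ k.+1 + (P k)^`().
Proof.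
have := deriv_legendre_succ k.+1; rewrite deriv_legendre_diff.
move=> H; have {H} : P k.+1 *+ k.+2 + P k.+1 *+ k.+1 + (P k)^`() = P k.+1 *+ k.+2 + 'X *
  (P k.+1)^`().
  by rewrite -H -mulrnDr; congr (_ *+ _ + _); rewrite addSn addnS mul2n -addnn.
by rewrite -addrA => /addrI.
Qed.

Lemma legendre0 : P 0 = 1.
Proof. by rewrite /legendre derivn0 expr0 expn0 fact0 muln1 invr1 scale1r. Qed.

Lemma legendre1 : P 1 = 'X.
Proof. by rewrite legendre_succ_Rodrigues derivn0 expr0 mulr1 /c expn0 fact0 muln1 invr1
  scale1r. Qed.

(** With [quad_deriv_legendre_down], these two expressions of
    [(X^2 - 1) P_k'] give the recurrence when compared. *)
Lemma quad_deriv_legendre_up k :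
  ('X^2 - 1) * (P k)^`() = (P k.+1 - 'X * P k) *+ k.+1.
Proof.
have h1 := deriv_legendre_succ k; have h2 := Xderiv_legendre_succ k.
have : ('X^2 - 1) * (P k)^`() = 'X * ((P k.+1)^`() - P k *+ k.+1) -
  ('X * (P k.+1)^`() - P k.+1 *+ k.+1).
  by rewrite h2 h1; ring.
by move=> ->; ring.
Qed.

Lemma quad_deriv_legendre_down k :
  ('X^2 - 1) * (P k.+1)^`() = ('X * P k.+1 - P k) *+ k.+1.
Proof.
have h1 := deriv_legendre_succ k; have h2 := Xderiv_legendre_succ k.
have -> : ('X^2 - 1) * (P k.+1)^`() = 'X * ('X * (P k.+1)^`()) - (P k.+1)^`() by ring.
by rewrite h2 h1; ring.
Qed.

Lemma bonnet k :
  P k.+2 *+ k.+2 = ('X * P k.+1) *+ (2 * k).+3 - P k *+ k.+1.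
Proof.
have := quad_deriv_legendre_up k.+1; rewrite quad_deriv_legendre_down => H.
have -> : P k.+2 *+ k.+2 = (P k.+2 - 'X * P k.+1) *+ k.+2 + ('X * P k.+1) *+ k.+2 by rewrite
  -mulrnDl subrK.
rewrite -H.
ring.
Qed.

Lemma legendre_at1 k : (P k).[1] = 1.
Proof.
elim: k => [|k IH]; first by rewrite legendre0 hornerC.
have /(congr1 (fun p => p.[1])) := quad_deriv_legendre_up k.
rewrite hornerM hornerMn !hornerD !hornerN hornerXn hornerM hornerX hornerC IH expr1n subrr
  mul0r => /esym/eqP.
by rewrite mulrn_eq0 /= subr_eq0 mulr1 => /eqP.
Qed.

Lemma legendre_atN1 k : (P k).[-1] = (-1) ^+ k.
Proof.
elim: k => [|k IH]; first by rewrite legendre0 hornerC.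
have /(congr1 (fun p => p.[-1])) := quad_deriv_legendre_up k.
rewrite hornerM hornerMn !hornerD !hornerN hornerXn hornerM hornerX hornerC IH sqrrN expr1n
  subrr mul0r => /esym/eqP.
by rewrite mulrn_eq0 /= subr_eq0 exprS => /eqP ->; rewrite mulN1r.
Qed.

(** The primitive of [P_k] that vanishes at both ends for [k > 0]; at [k = 0]
    it is the odd one. *)
Definition legendre_prim (k : nat) : {poly R} :=
  if k is k'.+1 then ((2 * k)%:R + 1)^-1 *: (P k.+1 - P k') else 'X.

Local Notation Q := legendre_prim.

Lemma double_plus1_neq0 k : (2 * k)%:R + 1 != 0 :> R.
Proof. by rewrite natr1 pnatr_eq0. Qed.

Lemma deriv_legendre_prim k : (Q k)^`() = P k.
Proof.
case: k => [|k]; first by rewrite derivX legendre0.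
rewrite /= derivZ derivB deriv_legendre_diff addrK -scalerMnr scalerMnl -[_ *+ _]mulr_natr.
by rewrite (_ : (2 * k).+3%:R = (2 * k.+1)%:R + 1) ?mulVf ?scale1r ?double_plus1_neq0 // natr1
  mulnS.
Qed.

Lemma legendre_prim_at1 k : (Q k.+1).[1] = 0.
Proof. by rewrite hornerZ hornerD hornerN !legendre_at1 subrr mulr0. Qed.

Lemma legendre_prim_atN1 k : (Q k.+1).[-1] = 0.
Proof. by rewrite hornerZ hornerD hornerN !legendre_atN1 !exprS !mulN1r opprK subrr mulr0. Qed.

(** A second primitive of [P_k] for [k > 0]; it vanishes at [1] from [k = 2] on. *)
Definition legendre_prim2 k : {poly R} :=
  if k is k'.+1 then ((2 * k)%:R + 1)^-1 *: (Q k.+1 - Q k') else 0.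

Lemma deriv_legendre_prim2 k : (legendre_prim2 k.+1)^`() = Q k.+1.
Proof. by rewrite /legendre_prim2 derivZ derivB !deriv_legendre_prim. Qed.

Lemma deriv_legendre_rec n :
  (P n.+3)^`() *+ n.+2 = ('X * (P n.+2)^`()) *+ (2 * n + 5) - (P n.+1)^`() *+ n.+3.
Proof.
rewrite (deriv_legendre_succ n.+2).
have -> : (P n.+1)^`() = 'X * (P n.+2)^`() - P n.+2 *+ n.+2 by rewrite Xderiv_legendre_succ
  addrAC subrr add0r.
ring.
Qed.

(** Legendre's differential equation, integrated once. *)
Lemma legendre_prim_quad k :
  Q k.+1 *+ (k.+1 * k.+2) = ('X^2 - 1) * (P k.+1)^`().
Proof.
have b := bonnet k.
have h := quad_deriv_legendre_up k.+1.
have n0 := double_plus1_neq0 k.+1.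
(* clear the denominator of the primitive *)
apply: (@mulfI _ ((2 * k.+1)%:R + 1)%:P); first by rewrite polyC_eq0.
have -> : ((2 * k.+1)%:R + 1)%:P * (Q k.+1 *+ (k.+1 * k.+2)) = (P k.+2 - P k) *+ (k.+1 * k.+2).
  by rewrite mulrnAr mul_polyC [Q _]/= scalerA divff // scale1r.
rewrite h polyCD polyC1 polyCMn polyC1.
have b' : P k *+ k.+1 = ('X * P k.+1) *+ (2 * k).+3 - P k.+2 *+ k.+2 by rewrite b; ring.
rewrite mulrnBl (mulrnA (P k)) b'.
ring.
Qed.

Lemma poly_eq_deriv (p q : {poly R}) (a : R) :
  p^`() = q^`() -> p.[a] = q.[a] -> p = q.
Proof.
move=> pq' pqa; apply/eqP; rewrite -subr_eq0; apply/eqP; set r := p - q.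
have r' : r^`() = 0 by rewrite derivB pq' subrr.
have rC : r = (r`_0)%:P.
  apply/polyP => -[|i]; rewrite coefC //=.
  by have /eqP := congr1 (fun s : {poly R} => s`_i) r';
    rewrite coef_deriv coef0 mulrn_eq0 /= => /eqP.
have : r.[a] = 0 by rewrite hornerD hornerN pqa subrr.
by rewrite rC hornerC => ->.
Qed.

(** Differentiating reduces this to the recurrence for [P]; at [1] both sides
    vanish, the coefficient [k] killing the only primitive that does not. *)
Lemma legendre_prim_rec k :
  Q k.+2 *+ k.+3 = ('X * Q k.+1) *+ (2 * k).+3 - Q k *+ k.
Proof.
apply: (@poly_eq_deriv _ _ 1).
  rewrite !(derivB, derivMn, derivM, derivX, mul1r, deriv_legendre_prim) mulrnDl.
  have -> : Q k.+1 *+ (2 * k).+3 = P k.+2 - P k.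
    rewrite /= scalerMnl -[_ *+ _]mulr_natr (_ : (2 * k).+3%:R = (2 * k.+1)%:R + 1);
      last by rewrite natr1 mulnS.
    by rewrite mulVf ?scale1r ?double_plus1_neq0.
  by rewrite [LHS]mulrS bonnet; ring.
rewrite hornerMn hornerD hornerN !hornerMn hornerM !legendre_prim_at1 mulr0 !mul0rn.
by case: k => [|k]; rewrite ?mulr0n ?subr0 // legendre_prim_at1 mul0rn subr0.
Qed.

Lemma legendre_prim2_at1 k : (legendre_prim2 k.+2).[1] = 0.
Proof. by rewrite hornerZ hornerD hornerN !legendre_prim_at1 subrr mulr0. Qed.

(** Again by differentiation, from [legendre_prim_rec]. *)
Lemma legendre_prim2_rec k :
  legendre_prim2 k.+3 *+ (k + 5) = ('X * legendre_prim2 k.+2) *+ (2 * k + 5) - legendre_prim2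
    k.+1 *+ k.
Proof.
apply: (@poly_eq_deriv _ _ 1).
  rewrite !(derivB, derivMn, derivM, derivX, mul1r, deriv_legendre_prim2) mulrnDl.
  have -> : legendre_prim2 k.+2 *+ (2 * k + 5) = Q k.+3 - Q k.+1.
    rewrite [legendre_prim2 _]/= scalerMnl -[_ *+ _]mulr_natr
      (_ : (2 * k + 5)%:R = (2 * k.+2)%:R + 1); last by rewrite natr1 !mulnS addnC.
    by rewrite mulVf ?scale1r ?double_plus1_neq0.
  have := legendre_prim_rec k.+1 => H.
  have -> : Q k.+3 *+ (k + 5) = Q k.+3 + Q k.+3 *+ k.+4 by rewrite -mulrS addnS addn4.
  by rewrite H; ring.
rewrite hornerMn hornerD hornerN !hornerMn hornerM !legendre_prim2_at1 mulr0 !mul0rn.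
by case: k => [|k]; rewrite ?mulr0n ?subr0 // legendre_prim2_at1 mul0rn subr0.
Qed.

End LegendreAlgebra.

(** * Ultraspherical polynomials in terms of Legendre polynomials *)

Section Ultraspherical.
Variable R : realType.
Implicit Types (b x r : R) (n : nat).

Let h x : {poly R} := 'X^2 - (2 * x) *: 'X + 1.

Lemma deriv_gen_base x : (h x)^`() = 'X *+ 2 - (2 * x)%:P.
Proof.
rewrite /h derivD derivB derivZ derivX derivXn -polyC1 derivC addr0 /= expr1.
by rewrite -mul_polyC polyC1 mulr1.
Qed.

(** The [n]-th derivative of [h^b] is this polynomial times [h^(b - n)]. *)
Fixpoint gegenbauer_num b x n : {poly R} :=
  if n is m.+1 then
    (gegenbauer_num b x m)^`() * h x + (b - m%:R) *: ((h x)^`() * gegenbauer_num b x m)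
  else 1.
Local Notation q := gegenbauer_num.

Lemma derive1n_gen_fun b x n r : 0 < (h x).[r] ->
  derive1n n (fun r => (h x).[r] `^ b) r = (q b x n).[r] * (h x).[r] `^ (b - n%:R).
Proof.
elim: n r => [|n IH] r hr; first by rewrite subr0 hornerC mul1r.
have nr : \forall s \near r, (q b x n).[s] * (h x).[s]
  `^ (b - n%:R) = derive1n n (fun r => (h x).[r] `^ b) s.
  have : \forall s \near r, 0 < (h x).[s].
    have /cvgr_gt := @continuous_horner R (h x) r; exact.
  by apply: filterS => s /IH.
rewrite derive1nS derive1E.
rewrite -(near_eq_derive _ nr).
have dh := is_derive_poly (h x) r.
have dp := is_derive1_powR (b - n%:R) hr.
have dc := @is_derive1_comp R (fun a => a `^ (b - n%:R)) (horner (h x)) r _ _ dp dh.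
have dm := @is_deriveM R _ (horner (q b x n)) _ r 1 _ _ (is_derive_poly (q b x n) r) dc.
have -> : (q b x n.+1).[r] = (q b x n)^`().[r] * (h x).[r]
    + (b - n%:R) * ((h x)^`().[r] * (q b x n).[r]).
  by rewrite hornerD hornerM hornerZ hornerM.
rewrite (@derive_val _ _ _ _ _ _ _ dm) /= -[n.+1]addn1 natrD opprD addrA.
have -> : (h x).[r] `^ (b - n%:R) = (h x).[r] * (h x).[r] `^ (b - n%:R - 1).
  rewrite -{2}(powRr1 (ltW hr)) -powRD; first by rewrite [1 + _]addrC subrK.
  by rewrite (gt_eqF hr) implybT.
rewrite /GRing.scale /=; ring.
Qed.

(** This is specific to a base [h] of degree two with leading coefficient one:
    it turns the first-order definition of the numerators into a three-term
    recurrence in [n]. *)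
Lemma deriv_gegenbauer_num b x n :
  (q b x n.+1)^`() = (n.+1%:R * (2 * b - n%:R)) *: q b x n.
Proof.
have h2 : (h x)^`()^`() = 2%:P.
  by rewrite deriv_gen_base derivB derivC derivMn derivX subr0 -polyC1 -polyCMn.
elim: n => [|n IH].
  rewrite /= derivD derivM derivZ derivM h2 -polyC1 derivC deriv0 -!mul_polyC !polyCM !polyCB.
  ring.
set p := q b x n.+1; rewrite [q b x n.+2]/= -/p derivD derivM derivZ derivM h2 IH derivZ.
have -> : p = (q b x n)^`() * h x + (b - n%:R) *: ((h x)^`() * q b x n) by [].
rewrite -!mul_polyC !(polyCM, polyCB, polyCMn) -[n.+2]addn2 -[n.+1]addn1 !natrD.
ring.
Qed.

Lemma ultrasphericalE (l x : R) n :
  ultraspherical l n x = (q (- l) x n).[0] / n`!%:R.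
Proof.
have h0 : (h x).[0] = 1 by rewrite !hornerE; ring.
rewrite /ultraspherical (_ : (fun r => _) = fun r => (h x).[r] `^ (- l)); last first.
  by apply/funext => r; congr (_ `^ _); rewrite !hornerE; ring.
by rewrite derive1n_gen_fun h0 ?powR1 ?mulr1.
Qed.

Lemma ultraspherical0 (l x : R) : ultraspherical l 0 x = 1.
Proof. by rewrite ultrasphericalE hornerC fact0 divr1. Qed.

Lemma ultraspherical1 (l x : R) : ultraspherical l 1 x = 2 * l * x.
Proof.
rewrite ultrasphericalE /= deriv_gen_base -polyC1 derivC mul0r add0r subr0 polyC1 mulr1.
rewrite hornerZ hornerD hornerN hornerMn hornerX hornerC factS fact0.
by field.
Qed.

Lemma ultraspherical_rec (l x : R) n :
  n.+2%:R * ultraspherical l n.+2 x =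
    2 * x * (n.+1%:R + l) * ultraspherical l n.+1 x - (n%:R + 2 * l) * ultraspherical l n x.
Proof.
have h0 : (h x).[0] = 1 by rewrite !hornerE; ring.
rewrite !ultrasphericalE; set p1 := q _ _ n.+1.
have -> : q (- l) x n.+2 = p1^`() * h x + (- l - n.+1%:R) *: ((h x)^`() * p1) by [].
rewrite deriv_gegenbauer_num !factS !natrM.
rewrite deriv_gen_base hornerD !hornerM !hornerZ hornerM h0.
rewrite (_ : (_ - (2 * x)%:P).[0] = - (2 * x));
  last by rewrite hornerD hornerN hornerMn hornerX hornerC mul0rn sub0r.
field.
by rewrite nat1r -natrD !pnatr_eq0 -lt0n fact_gt0.
Qed.

Local Notation P := (legendre R).

(** Both sides satisfy the same recurrence; this is the identity
    [C_n^(3/2) = P_(n+1)']. *)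
Lemma ultraspherical_legendre n x :
  ultraspherical (3 / 2) n x = (P n.+1)^`().[x].
Proof.
suff: ultraspherical (3 / 2) n x = (P n.+1)^`().[x]
  /\ ultraspherical (3 / 2) n.+1 x = (P n.+2)^`().[x].
  by case.
elim: n => [|n [IH1 IH2]].
  rewrite ultraspherical0 ultraspherical1 deriv_legendre_diff legendre0 legendre1 derivX derivC.
  rewrite -polyC1 addr0 hornerMn hornerX hornerC; split => //.
  by rewrite [in RHS]/=; field.
split=> //; have /(congr1 (fun p => p.[x])) := deriv_legendre_rec R n.
rewrite hornerMn [RHS]hornerD [X in _ + X]hornerN [X in _ - X]hornerMn [X in X - _]hornerMn
  hornerM hornerX -IH1 -IH2 => H.
apply: (@mulfI _ n.+2%:R); first by rewrite pnatr_eq0.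
rewrite ultraspherical_rec [RHS]mulr_natl H; by field.
Qed.

(** By Legendre's equation, [(1 - x^2) P_j'] is a multiple of the primitive. *)
Lemma ultraspherical_mhalfE j x :
  ultraspherical_mhalf j.+1 x = - (legendre_prim R j).[x].
Proof.
case: j => [|j]; first by rewrite /= hornerX.
rewrite /ultraspherical_mhalf ultraspherical_legendre.
have /(congr1 (fun p => p.[x])) := legendre_prim_quad R j.
rewrite hornerM hornerMn hornerD hornerN hornerXn hornerC => H.
have -> : 1 - x ^+ 2 = - (x ^+ 2 - 1) by rewrite opprB.
rewrite mulNr -H mulNr -[_ *+ _]mulr_natr mulnC mulfK //.
Qed.

Lemma horner_bonnet k x :
  k.+2%:R * (P k.+2).[x] = (2 * k%:R + 3) * (x * (P k.+1).[x]) - k.+1%:R * (P k).[x].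
Proof.
have /(congr1 (fun p => p.[x])) := bonnet R k.
rewrite hornerMn [RHS]hornerD [X in _ + X]hornerN [X in _ - X]hornerMn [X in X - _]hornerMn
  hornerM hornerX.
by rewrite mulr_natl => ->; ring.
Qed.

Lemma horner_legendre_prim k x :
  (legendre_prim R k.+1).[x] = ((2 * k.+1)%:R + 1)^-1 * ((P k.+2).[x] - (P k).[x]).
Proof. by rewrite hornerZ hornerD hornerN. Qed.

Lemma horner_legendre_prim2 k x :
  (legendre_prim2 R k.+1).[x] = ((2 * k.+1)%:R + 1)^-1 *
    ((legendre_prim R k.+2).[x] - (legendre_prim R k).[x]).
Proof. by rewrite hornerZ hornerD hornerN. Qed.

Lemma ultraspherical_m3half0 x :
  ultraspherical (- (3 / 2)) 2 x / 3 = 1 / 2 + x ^+ 2 / 2.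
Proof.
have := ultraspherical_rec (- (3 / 2)) x 0; rewrite ultraspherical1 ultraspherical0.
lra.
Qed.

(** Same recurrence, started at degrees three and four.  Degree two does not
    fit, hence [ultraspherical_m3half0]. *)
Lemma ultraspherical_m3halfE k x :
  ultraspherical (- (3 / 2)) k.+3 x / 3 = (legendre_prim2 R k.+1).[x].
Proof.
have P2 : (P 2).[x] = (3 * x ^+ 2 - 1) / 2.
  by have := horner_bonnet 0 x; rewrite legendre0 legendre1 hornerX hornerC; lra.
have P3 : (P 3).[x] = (5 * x ^+ 3 - 3 * x) / 2.
  by have := horner_bonnet 1 x; rewrite legendre1 hornerX P2; lra.
have P4 : (P 4).[x] = (35 * x ^+ 4 - 30 * x ^+ 2 + 3) / 8.
  by have := horner_bonnet 2 x; rewrite P2 P3; lra.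
have c2 := ultraspherical_m3half0 x.
have c3 := ultraspherical_rec (- (3 / 2)) x 1; rewrite ultraspherical1 in c3.
have c4 := ultraspherical_rec (- (3 / 2)) x 2.
have u2 : ultraspherical (- (3 / 2)) 2 x = 3 / 2 + 3 / 2 * x ^+ 2 by lra.
have u3 : ultraspherical (- (3 / 2)) 3 x = 3 * (x ^+ 3 / 6 - x / 2).
  by rewrite u2 in c3; lra.
have u4 : ultraspherical (- (3 / 2)) 4 x = 3 * (x ^+ 4 / 8 - x ^+ 2 / 4 + 1 / 8).
  by rewrite u2 u3 in c4; lra.
suff: ultraspherical (- (3 / 2)) k.+3 x / 3 = (legendre_prim2 R k.+1).[x] /\
  ultraspherical (- (3 / 2)) k.+4 x / 3 = (legendre_prim2 R k.+2).[x] by case.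
elim: k => [|k [IH1 IH2]].
  rewrite !horner_legendre_prim2 !horner_legendre_prim [(legendre_prim R 0).[x]]hornerX.
  by rewrite legendre0 legendre1 hornerC hornerX P3 P4 P2 u3 u4 /=; split; field.
split=> //; have /(congr1 (fun p => p.[x])) := legendre_prim2_rec R k.
rewrite hornerMn [RHS]hornerD [X in _ + X]hornerN [X in _ - X]hornerMn [X in X - _]hornerMn
  hornerM hornerX -IH1 -IH2 => H.
apply: (@mulfI _ (k + 5)%:R); first by rewrite addnC pnatr_eq0.
rewrite [RHS]mulr_natl H mulrA [(k + 5)%N]addnC ultraspherical_rec; by field.
Qed.

End Ultraspherical.

(** * Integrability of real functions *)

Section RealIntegrable.
Context d (T : measurableType d) (R : realType).
Variables (m : {measure set T -> \bar R}) (D : set T).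
Hypothesis mD : measurable D.
Implicit Types f g : T -> R.

Lemma rintegrableD f g : m.-integrable D (EFin \o f) -> m.-integrable D (EFin \o g) ->
  m.-integrable D (EFin \o (fun t => f t + g t)).
Proof. exact: integrableD. Qed.

Lemma rintegrableB f g : m.-integrable D (EFin \o f) -> m.-integrable D (EFin \o g) ->
  m.-integrable D (EFin \o (fun t => f t - g t)).
Proof. exact: integrableB. Qed.

Lemma rintegrableZ f k : m.-integrable D (EFin \o f) ->
  m.-integrable D (EFin \o (fun t => k * f t)).
Proof. exact: integrableZl. Qed.

Lemma rintegrableM f g : m.-integrable D (EFin \o f) -> measurable_fun D g ->
  [bounded g x | x in D] -> m.-integrable D (EFin \o (fun t => f t * g t)).
Proof. by move=> intf mg bg; exact: (integrableMl mD intf mg bg). Qed.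

Lemma rintegrable_norm f : m.-integrable D (EFin \o f) ->
  m.-integrable D (EFin \o (fun t => `|f t|)).
Proof. by move=> /integrable_abse. Qed.

Lemma rintegrable_le f g : measurable_fun D f -> (forall x, D x -> `|f x| <= g x) ->
  m.-integrable D (EFin \o g) -> m.-integrable D (EFin \o f).
Proof.
move=> mf fg; apply: le_integrable => //; first exact/measurable_EFinP.
by move=> x Dx; rewrite /= lee_fin (le_trans (fg x Dx)) // ler_norm.
Qed.

Lemma rintegrable_eq f g : (forall x, D x -> f x = g x) ->
  m.-integrable D (EFin \o f) -> m.-integrable D (EFin \o g).
Proof.
by move=> fg; apply: eq_integrable => // x; rewrite inE => Dx; rewrite /= fg.
Qed.

End RealIntegrable.

(** * Integration by parts for logarithmic singularities *)

Section Improper.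
Variable R : realType.
Local Notation mu := (@lebesgue_measure R).
Implicit Types (f F : R -> R) (p q w : R).

(** The integrand need not be bounded near the ends: the indefinite integral of
    an integrable function is continuous, and it differs from [F] by a function
    with zero derivative. *)
Lemma Rintegral_open_FTC f F p q : p <= q ->
  mu.-integrable `[p, q] (EFin \o f) ->
  {in `]p, q[, continuous f} ->
  {in `]p, q[, forall t, is_derive t (1 : R) F (f t)} ->
  {within `[p, q], continuous F} ->
  \int[mu]_(t in `[p, q]) f t = F q - F p.
Proof.
rewrite le_eqVlt => /predU1P[->|pq]; first by rewrite set_itv1 Rintegral_set1 subrr.
move=> intf cf dF cF.
pose G x := \int[mu]_(t in `[p, x]) f t.
have cG : {within `[p, q], continuous G}.
  exact: parameterized_integral_continuous (ltW pq) intf.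
have dGF x : x \in `]p, q[ -> is_derive x (1 : R) (G - F) (0 : R).
  move=> xpq; move: (xpq); rewrite in_itv/= => /andP[px xq].
  have [Gx G'x] := continuous_FTC1_closed xq intf px (cf x xpq).
  have dG : is_derive x (1 : R) G (f x).
    by apply: DeriveDef; [exact: Gx|rewrite -derive1E G'x].
  by have := is_deriveB dG (dF x xpq); rewrite subrr.
have [c cpq] := MVT pq dGF (fun x => cvgB (cG x) (cF x)).
rewrite mul0r !fctE => /eqP.
have -> : G p = 0 by rewrite /G set_itv1 Rintegral_set1.
by rewrite -/(G q) => /eqP; lra.
Qed.

(** Monotone convergence along the segments [[p + d/(n+3), q - d/(n+3)]], on
    which the integral is a difference of two values of [F]. *)
Lemma open_FTC_integrable f F p q M : p < q ->
  {in `]p, q[, continuous f} ->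
  {in `]p, q[, forall t, 0 <= f t} ->
  {in `]p, q[, forall t, is_derive t (1 : R) F (f t)} ->
  {in `]p, q[, forall t, `|F t| <= M} ->
  mu.-integrable `]p, q[ (EFin \o f).
Proof.
move=> pq cf f0 dF FM.
(* the denominator is at least 3, so that p + e n < q - e n *)
pose e n : R := (q - p) / n.+3%:R.
have e0 n : 0 < e n by rewrite divr_gt0 ?subr_gt0.
have e2 n : e n < (q - p) / 2 by rewrite ltr_pM2l ?subr_gt0 // ltf_pV2 ?posrE // ltr_nat.
have enn n m : (n <= m)%N -> e m <= e n.
  by move=> nm; rewrite ler_pM2l ?subr_gt0 // lef_pV2 ?posrE // ler_nat.
pose S n := `[p + e n, q - e n]%classic.
have Spq n : S n `<=` `]p, q[.
  move=> t; rewrite /S /= !in_itv/= => /andP[h1 h2]; have := e0 n.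
  by move=> ?; apply/andP; split; lra.
have US : \bigcup_n S n = `]p, q[%classic.
  apply/seteqP; split=> [t [n _ /Spq]//|t].
  rewrite /= in_itv/= => /andP[pt tq].
  pose m := Num.min (t - p) (q - t).
  have m0 : 0 < m by rewrite lt_min !subr_gt0 pt.
  have [n nm] : exists n, e n < m.
    exists (Num.truncn ((q - p) / m)); rewrite /e ltr_pdivrMr // -ltr_pdivrMl // mulrC.
    apply: (lt_le_trans (truncnS_gt _)).
    by rewrite ler_nat; apply: leqW.
  exists n => //; rewrite /S /= in_itv/=.
  move: nm; rewrite lt_min => /andP[h1 h2].
  by apply/andP; split; lra.
have mf : measurable_fun `]p, q[ f.
  by apply: open_continuous_measurable_fun; [exact: interval_open|move=> x /[!inE]; exact: cf].
apply/integrableP; split; first exact/measurable_EFinP.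
rewrite (_ : (\int[mu]_(x in `]p, q[) `|(EFin \o f) x| = \int[mu]_(x in `]p, q[) (f x)%:E)%E);
  last first.
  by apply: eq_integral => t; rewrite inE/= => tpq; rewrite /= ger0_norm // f0.
have int_le n : (\int[mu]_(x in S n) (f x)%:E <= (2 * M)%:E)%E.
  have pe : p + e n < q - e n by have := e2 n; lra.
  have pin : p + e n \in `]p, q[ by rewrite in_itv/=; have := e2 n; have := e0 n => ? ?;
    apply/andP; split; lra.
  have qin : q - e n \in `]p, q[ by rewrite in_itv/=; have := e2 n; have := e0 n => ? ?;
    apply/andP; split; lra.
  rewrite (@continuous_FTC2 _ f F _ _ pe).
  - rewrite -EFinB lee_fin; have := FM _ pin; have := FM _ qin.
    by rewrite !ler_norml => /andP[? ?] /andP[? ?]; lra.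
  - by apply: continuous_in_subspaceT => x /[!inE] /Spq; exact: cf.
  - split.
    + by move=> x xS; apply: (@ex_derive _ _ _ _ _ _ _ (dF x _)); apply: (Spq n); rewrite /S;
        apply: subset_itv_oo_cc.
    + by apply: cvg_at_right_filter; apply: differentiable_continuous; apply/derivable1_diffP;
        case: (dF _ pin).
    + by apply: cvg_at_left_filter; apply: differentiable_continuous; apply/derivable1_diffP;
        case: (dF _ qin).
  - move=> x xS; rewrite derive1E; apply: derive_val.
    by apply: dF; apply: (Spq n); rewrite /S; apply: subset_itv_oo_cc.
apply: (@le_lt_trans _ _ (2 * M)%:E); last by rewrite ltry.
have cvgS : (\int[mu]_(x in S i) (f x)%:E)%E @[i --> \oo]
  --> (\int[mu]_(x in \bigcup_i S i) (f x)%:E)%E.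
  apply: ge0_nondecreasing_set_cvg_integral.
  - apply/nondecreasing_seqP => n; apply/subsetPset; rewrite /S => t; rewrite /= !in_itv/=.
    by have := enn _ _ (leqnSn n) => ? /andP[? ?]; apply/andP; split; lra.
  - by move=> n; exact: measurable_itv.
  - by move=> n; apply/measurable_EFinP; apply: measurable_funS mf => //.
  - by move=> n x /Spq xpq; rewrite lee_fin f0.
rewrite US in cvgS; rewrite -(cvg_lim _ cvgS) //.
apply: lime_le; first by apply/cvg_ex; exists (\int[mu]_(x in `]p, q[) (f x)%:E)%E.
by apply: nearW => n; exact: int_le.
Qed.

Lemma Rintegral_FTC_except f F p q w : p <= q ->
  mu.-integrable `[p, q] (EFin \o f) -> continuous F ->
  (forall t, t != w -> {for t, continuous f}) ->
  (forall t, t != w -> is_derive t (1 : R) F (f t)) ->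
  \int[mu]_(t in `[p, q]) f t = F q - F p.
Proof.
move=> pq intf cF cf dF.
have [/andP[pw wq]|H] := boolP (p < w < q); last first.
  have ne t : t \in `]p, q[ -> t != w.
    by rewrite in_itv/= => tpq; apply: contraNneq H => <-.
  apply: Rintegral_open_FTC => //; last exact: continuous_subspaceT.
  - by move=> t /ne; exact: cf.
  - by move=> t /ne; exact: dF.
have := @Rintegral_itvB _ f (BLeft p) (BRight q) w intf.
rewrite !bnd_simp => /(_ (ltW pw) (ltW wq)).
have sub1 : `[p, w] `<=` `[p, q] by apply: subset_itvl; rewrite bnd_simp ltW.
have sub2 : `[w, q] `<=` `[p, q] by apply: subset_itvr; rewrite bnd_simp ltW.
have i1 : mu.-integrable `[p, w] (EFin \o f) by exact: integrableS intf.
have i2 : mu.-integrable `[w, q] (EFin \o f) by exact: integrableS intf.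
rewrite Rintegral_itv_obnd_cbnd; last by apply: integrableS i2 => //; apply: subset_itvr;
  rewrite bnd_simp.
rewrite (Rintegral_open_FTC (ltW pw) i1 (F := F)); last 3 first.
  by move=> t; rewrite in_itv/= => /andP[_ tw]; apply: cf; rewrite lt_eqF.
  by move=> t; rewrite in_itv/= => /andP[_ tw]; apply: dF; rewrite lt_eqF.
  exact: continuous_subspaceT.
rewrite (Rintegral_open_FTC (ltW wq) i2 (F := F)); last 3 first.
  by move=> t; rewrite in_itv/= => /andP[tw _]; apply: cf; rewrite gt_eqF.
  by move=> t; rewrite in_itv/= => /andP[tw _]; apply: dF; rewrite gt_eqF.
  exact: continuous_subspaceT.
lra.
Qed.

(** From [ln y < y] at [y = 1 / sqrt |v|]. *)
Lemma norm_xlnx (v : R) : `|v| <= 1 -> `|v * ln `|v| | <= 2 * Num.sqrt `|v|.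
Proof.
have [->|v0] := eqVneq v 0; first by rewrite mul0r normr0 sqrtr0 mulr0.
have {}v0 : 0 < `|v| by rewrite normr_gt0.
move=> v1; rewrite normrM (ler0_norm (ln_le0 v1)).
have s0 : 0 < Num.sqrt `|v| by rewrite sqrtr_gt0.
have vs : `|v| = Num.sqrt `|v| ^+ 2 by rewrite sqr_sqrtr // ltW.
set s := Num.sqrt _ in s0 vs *.
rewrite vs lnXn // -mulNrn -lnV ?posrE // mulr2n -mulr2n.
have := ln_sublinear (_ : 0 < s^-1); rewrite invr_gt0 => /(_ s0) H.
have sL : s * ln s^-1 <= 1 by rewrite -(mulfV (lt0r_neq0 s0)) ler_pM2l // ltW.
rewrite [leLHS](_ : _ = 2 * s * (s * ln s^-1)); last by ring.
by rewrite ler_piMr // mulr_ge0 // ltW.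
Qed.

Lemma continuous_xlnx : continuous (fun v : R => v * ln `|v|).
Proof.
move=> v; have [->|v0] := eqVneq v 0; last first.
  apply: cvgM => //; apply: continuous_comp; first exact: norm_continuous.
  by apply: continuous_ln; rewrite normr_gt0.
rewrite /continuous_at mul0r.
have cs : (fun v : R => 2 * Num.sqrt `|v|) @ 0 --> (0 : R).
  have cc : {for 0, continuous (fun v : R => 2 * Num.sqrt `|v|)}.
    apply: cvgM; first exact: cvg_cst.
    by apply: continuous_comp; [exact: norm_continuous|exact: sqrt_continuous].
  by move: cc; rewrite /prop_for /continuous_at normr0 sqrtr0 mulr0.
have cs' : (fun v : R => - (2 * Num.sqrt `|v|)) @ 0 --> (0 : R).
  by have := cvgN cs; rewrite oppr0; exact.
apply: (squeeze_cvgr _ cs' cs); near=> u.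
rewrite -ler_norml norm_xlnx //; near: u.
Unshelve. all: by end_near. Qed.

Definition ln_modulus (a b : R) : R := ln (Num.sqrt (a ^+ 2 + b ^+ 2)).

Lemma ln_modulusC a b : ln_modulus a b = ln_modulus b a.
Proof. by rewrite /ln_modulus addrC. Qed.

Lemma ln_modulus0 b : ln_modulus 0 b = ln `|b|.
Proof. by rewrite /ln_modulus expr0n add0r sqrtr_sqr. Qed.

Lemma is_derive_ln_modulus c (v : R) : v != 0 -> is_derive v (1 : R) (ln_modulus c)
  (v / (c ^+ 2 + v ^+ 2)).
Proof.
move=> v0.
have r0 : 0 < c ^+ 2 + v ^+ 2 by rewrite ltr_wpDl ?sqr_ge0 // exprn_even_gt0.
have s0 : 0 < Num.sqrt (c ^+ 2 + v ^+ 2) by rewrite sqrtr_gt0.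
have d1 : is_derive v (1 : R) (fun v : R => c ^+ 2 + v ^+ 2) (2 * v).
  by apply: trigger_derive; rewrite add0r mul1r /GRing.scale /= mulr1 mulr_natl mulr2n.
have d2 := @is_derive1_comp R Num.sqrt (fun v => c ^+ 2 + v ^+ 2) v _ _ (is_derive1_sqrt r0) d1.
have d3 := @is_derive1_comp R (@ln R) (fun v => Num.sqrt (c ^+ 2 + v ^+ 2)) v _ _
  (is_derive1_ln s0) d2.
apply: (trigger_derive d3); rewrite -[in RHS](sqr_sqrtr (ltW r0)).
by field; rewrite lt0r_neq0.
Qed.

Lemma continuous_ln_modulus c (v : R) : (c != 0) ||
  (v != 0) -> {for v, continuous (ln_modulus c)}.
Proof.
move=> cv; have r0 : 0 < c ^+ 2 + v ^+ 2.
  rewrite lt0r paddr_eq0 ?sqr_ge0 // !sqrf_eq0 addr_ge0 ?sqr_ge0 // andbT.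
  by rewrite negb_and.
apply: continuous_comp; last by apply: continuous_ln; rewrite sqrtr_gt0.
apply: continuous_comp; last exact: sqrt_continuous.
by apply: cvgD; [exact: cvg_cst|exact: exprn_continuous].
Qed.

Lemma continuous_mul_ln_modulus c : continuous (fun v : R => v * ln_modulus c v).
Proof.
have [->|c0] := eqVneq c 0; last first.
  by move=> v; apply: cvgM => //; apply: continuous_ln_modulus; rewrite c0.
rewrite (_ : (fun v => _) = fun v => v * ln `|v|); first exact: continuous_xlnx.
by apply/funext => v; rewrite ln_modulus0.
Qed.

Lemma continuous_scale_ln_modulus c : continuous (fun v : R => c * ln_modulus c v).
Proof.
have [->|c0] := eqVneq c 0; last first.
  by move=> v; apply: cvgM; [exact: cvg_cst|apply: continuous_ln_modulus; rewrite c0].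
rewrite (_ : (fun v => _) = cst 0); first exact: cst_continuous.
by apply/funext => v; rewrite mul0r.
Qed.

(** Along a line at signed distance [c] from the origin, the argument is of this
    form, with a constant [k] depending on the branch. *)
Definition branch_arg (k c v : R) : R := k + atan (v / c).

Lemma is_derive_branch_arg k c (v : R) : is_derive v (1 : R) (branch_arg k c)
  ((1 + (v / c) ^+ 2)^-1 / c).
Proof.
have d1 : is_derive v (1 : R) (fun v : R => v / c) c^-1.
  by apply: trigger_derive; rewrite scaler0 add0r /GRing.scale /= mulr1.
have d2 := @is_derive1_comp R (@atan R) (fun v => v / c) v _ _ (is_derive1_atan (v / c)) d1.
by apply: (trigger_derive (is_deriveD (is_derive_cst k v (1 : R)) d2)); rewrite add0r.
Qed.

Lemma continuous_branch_arg k c : continuous (branch_arg k c).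
Proof.
move=> v; apply: differentiable_continuous; apply/derivable1_diffP.
by case: (is_derive_branch_arg k c v).
Qed.

(** With [zlog_angular], the two components of [u log u] along a line at
    distance [c], as functions of the position [v]: this one has derivative
    [ln |u| + 1], the other one minus the argument. *)
Definition zlog_radial k c v : R := v * ln_modulus c v + c * branch_arg k c v.
Definition zlog_angular k c v : R := c * ln_modulus c v - v * branch_arg k c v.

Lemma is_derive_zlog_radial k c (v : R) : v != 0 ->
  is_derive v (1 : R) (zlog_radial k c) (ln_modulus c v + 1).
Proof.
move=> v0.
have r0 : 0 < c ^+ 2 + v ^+ 2 by rewrite ltr_wpDl ?sqr_ge0 // exprn_even_gt0.
have d1 := is_derive_ln_modulus c v0; have d2 := is_derive_branch_arg k c v.
apply: trigger_derive; rewrite /GRing.scale /=.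
have [->|c0] := eqVneq c 0.
  by rewrite invr0; field.
by field; rewrite c0 lt0r_neq0.
Qed.

Lemma is_derive_zlog_angular k c (v : R) : v != 0 ->
  is_derive v (1 : R) (zlog_angular k c) (- branch_arg k c v).
Proof.
move=> v0.
have r0 : 0 < c ^+ 2 + v ^+ 2 by rewrite ltr_wpDl ?sqr_ge0 // exprn_even_gt0.
have d1 := is_derive_ln_modulus c v0; have d2 := is_derive_branch_arg k c v.
apply: trigger_derive; rewrite /GRing.scale /=.
have [->|c0] := eqVneq c 0; first by rewrite invr0; ring.
by field; rewrite c0 lt0r_neq0.
Qed.

Lemma continuous_zlog_radial k c : continuous (zlog_radial k c).
Proof.
move=> v; apply: cvgD; first exact: continuous_mul_ln_modulus.
by apply: cvgM; [exact: cvg_cst|exact: continuous_branch_arg].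
Qed.

Lemma continuous_zlog_angular k c : continuous (zlog_angular k c).
Proof.
move=> v; apply: cvgB; first exact: continuous_scale_ln_modulus.
by apply: cvgM => //; exact: continuous_branch_arg.
Qed.

Lemma continuous_integrable f p q : continuous f ->
  mu.-integrable `[p, q] (EFin \o f).
Proof.
move=> cf; apply: continuous_compact_integrable; first exact: segment_compact.
exact: continuous_subspaceT.
Qed.

Lemma integrable_mul_continuous f g p q : continuous g ->
  mu.-integrable `[p, q] (EFin \o f) ->
  mu.-integrable `[p, q] (EFin \o (fun t => f t * g t)).
Proof.
move=> cg intf.
have mg : measurable_fun `[p, q] g.
  by apply: measurable_funTS; exact: continuous_measurable_fun.
have bg : [bounded g x | x in `[p, q]].
  have cg' : {within `[p, q], continuous g} by exact: continuous_subspaceT.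
  have /compact_bounded[M [_ mrt]] := continuous_compact cg' (@segment_compact _ p q).
  by exists M; split; rewrite ?num_real // => ? ? ? ?; exact: mrt.
exact: (integrableMl _ intf mg bg).
Qed.

Lemma continuous_comp_csub f w t : {for w - t, continuous f} ->
  {for t, continuous (fun t => f (w - t))}.
Proof.
move=> cf; apply: (@continuous_comp _ _ _ (fun t : R => w - t) f) => //.
by apply: cvgB => //; exact: cvg_cst.
Qed.

(** Up to the constant [ln D], which makes it of constant sign, the integrand
    has the bounded primitive [zlog_radial]. *)
Lemma integrable_ln_gap a b w D : a < b -> 0 < D ->
  {in `]a, b[, forall t, 0 < `|w - t| < D} ->
  mu.-integrable `]a, b[ (EFin \o (fun t => ln `|w - t|)).
Proof.
move=> ab D0 gap.
have ne t : t \in `]a, b[ -> w - t != 0.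
  by move=> /gap /andP[+ _]; rewrite normr_gt0.
pose F t := t * ln D + zlog_radial 0 0 (w - t) + t.
have cF : continuous F.
  move=> t; apply: cvgD => //; apply: cvgD; first by apply: cvgM => //; exact: cvg_cst.
  apply: (@continuous_comp _ _ _ (fun t : R => w - t) (zlog_radial 0 0));
    last exact: continuous_zlog_radial.
  by apply: cvgB => //; exact: cvg_cst.
have [M [_ FM]] := compact_bounded (continuous_compact (continuous_subspaceT cF)
  (@segment_compact _ a b)).
suff : mu.-integrable `]a, b[ (EFin \o (fun t => ln D - ln_modulus 0 (w - t))).
  have : mu.-integrable `]a, b[ (EFin \o (cst (ln D))).
    by apply: (@integrableS _ _ _ mu `[a, b]) => //;
      [exact: subset_itv_oo_cc|apply: continuous_integrable; exact: cst_continuous].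
  move=> i1 i2.
  apply: (@rintegrable_eq _ _ _ mu _ _ (fun t => ln D - (ln D - ln_modulus 0 (w - t)))) => //.
    by move=> t _; rewrite ln_modulus0; ring.
  exact: rintegrableB.
apply: (@open_FTC_integrable _ F _ _ (M + 1)) => //.
- move=> t /ne wt; apply: cvgB; first exact: cvg_cst.
  apply: (@continuous_comp _ _ _ (fun t : R => w - t) (ln_modulus 0)).
    by apply: cvgB => //; exact: cvg_cst.
  by apply: continuous_ln_modulus; rewrite wt orbT.
- move=> t tab; have /andP[h1 h2] := gap t tab.
  by rewrite ln_modulus0 subr_ge0 ler_ln ?posrE // ltW.
- move=> t /ne wt.
  have d0 : is_derive t (1 : R) (fun t => w - t) (-1).
    by apply: trigger_derive; rewrite add0r mul1r.
  have d1 := @is_derive1_comp R (zlog_radial 0 0) (fun t => w - t) t _ _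
    (is_derive_zlog_radial 0 0 wt) d0.
  apply: trigger_derive; rewrite /GRing.scale /=.
  by ring.
- move=> t; rewrite in_itv/= => /andP[at' tb].
  apply: (FM (M + 1)); first by rewrite ltrDl.
  by exists t => //; rewrite /= in_itv/= !ltW.
Qed.

(** At [t = w] the integrand is [ln 0 = 0], so it is the sum of its restrictions to
    the two sides of [w]. *)
Lemma integrable_ln p q w : mu.-integrable `[p, q] (EFin \o (fun t => ln `|w - t|)).
Proof.
(* large enough for [p, q] to lie in ]w - D, w + D[ *)
pose D := `|p - w| + `|q - w| + 1.
have D0 : 0 < D by rewrite ltr_wpDl.
have i1 : mu.-integrable `]w - D, w[ (EFin \o (fun t => ln `|w - t|)).
  apply: (@integrable_ln_gap _ _ _ D) => //; first by rewrite ltrBlDr ltrDl.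
  move=> t; rewrite in_itv/= => /andP[h1 h2].
  by rewrite gtr0_norm ?subr_gt0 // h2 /=; lra.
have i2 : mu.-integrable `]w, w + D[ (EFin \o (fun t => ln `|w - t|)).
  apply: (@integrable_ln_gap _ _ _ D) => //; first by rewrite ltrDl.
  move=> t; rewrite in_itv/= => /andP[h1 h2].
  by rewrite ltr0_norm ?subr_lt0 // opprB subr_gt0 h1 /=; lra.
have sub : `[p, q] `<=` `]w - D, w + D[.
  move=> t; rewrite /= !in_itv/= => /andP[h1 h2].
  have := ler_norm (p - w); have := ler_norm (q - w).
  have := ler_norm (- (p - w)); have := ler_norm (- (q - w)); rewrite !normrN.
  by move=> ? ? ? ?; apply/andP; rewrite /D; split; lra.
apply: (@integrableS _ _ _ mu `]w - D, w + D[) => //.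
set f := fun t => ln `|w - t|.
have j1 : mu.-integrable `]w - D, w + D[ (EFin \o (f \_ `]w - D, w[)).
  rewrite -restrict_EFin; apply/integrable_restrict => //.
  by rewrite setIidr // => t; rewrite /= !in_itv/= => /andP[? ?]; apply/andP; split => //; lra.
have j2 : mu.-integrable `]w - D, w + D[ (EFin \o (f \_ `]w, w + D[)).
  rewrite -restrict_EFin; apply/integrable_restrict => //.
  by rewrite setIidr // => t; rewrite /= !in_itv/= => /andP[? ?]; apply/andP; split => //; lra.
apply: (@rintegrable_eq _ _ _ mu _ _ (fun t => (f \_ `]w - D, w[) t + (f \_ `]w, w + D[) t)) =>
  //; last exact: rintegrableD.
move=> t; rewrite /= in_itv/= => /andP[h1 h2].
rewrite !patchE !mem_setE !in_itv/= h1 h2 andbT /=.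
have [tw|tw|tw] := ltgtP t w; rewrite ?addr0 ?add0r //.
by rewrite /f tw subrr normr0 ln0.
Qed.

Lemma measurable_ln_modulus c : measurable_fun setT (ln_modulus c).
Proof.
apply: measurableT_comp; first exact: measurable_ln.
apply: continuous_measurable_fun => v; apply: continuous_comp; last exact: sqrt_continuous.
by apply: cvgD; [exact: cvg_cst|exact: exprn_continuous].
Qed.

(** The bound holds everywhere, the origin and the axes included, because [ln 0]
    is zero. *)
Lemma norm_ln_modulus_le a b : `|ln_modulus a b| <= `|ln `|a| | + `|ln `|b| |
  + (1 + a ^+ 2 + b ^+ 2).
Proof.
have ge0 : 0 <= 1 + a ^+ 2 + b ^+ 2 by rewrite !addr_ge0 ?sqr_ge0.
have key u v : u != 0 -> `|ln_modulus u v| <= `|ln `|u| | + (1 + u ^+ 2 + v ^+ 2).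
  move=> u0; have nu : 0 < `|u| by rewrite normr_gt0.
  have r0 : 0 < u ^+ 2 + v ^+ 2 by rewrite ltr_wpDr ?sqr_ge0 // exprn_even_gt0.
  rewrite /ln_modulus; set s := Num.sqrt _; have s0 : 0 < s by rewrite sqrtr_gt0.
  have us : `|u| <= s by rewrite -sqrtr_sqr ler_wsqrtr // lerDl sqr_ge0.
  have h1 : ln `|u| <= ln s by rewrite ler_ln.
  have h2 := ln_sublinear s0.
  have h3 : s <= 1 + s ^+ 2 by have := sqr_ge0 (s - 1); nra.
  have h4 : s ^+ 2 = u ^+ 2 + v ^+ 2 by rewrite sqr_sqrtr // ltW.
  have h5 := ler_norm (- ln `|u|); rewrite normrN in h5.
  have h6 := normr_ge0 (ln `|u|).
  by rewrite ler_norml; apply/andP; split; lra.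
have [->|a0] := eqVneq a 0; last first.
  by have := key a b a0; have := normr_ge0 (ln `|b|); lra.
have [->|b0] := eqVneq b 0.
  by rewrite ln_modulus0 normr0 ln0 // normr0 expr0n /= !add0r !addr0.
rewrite ln_modulus0.
by have := normr_ge0 (ln `|0 : R|); have := sqr_ge0 b; have := sqr_ge0 (0 : R); lra.
Qed.

Lemma integrable_ln_modulus c p q w :
  mu.-integrable `[p, q] (EFin \o (fun t => ln_modulus c (w - t))).
Proof.
apply: (@rintegrable_le _ _ _ mu _ _ _ (fun t => (`|ln `|c| | + `|ln `|w - t| |) +
  (1 + c ^+ 2 + (w - t) ^+ 2))) => //.
- apply: measurable_funTS; apply: measurableT_comp; first exact: measurable_ln_modulus.
  by apply: continuous_measurable_fun => t; apply: cvgB => //; exact: cvg_cst.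
- by move=> t _; exact: norm_ln_modulus_le.
apply: rintegrableD => //.
  apply: rintegrableD => //; first by apply: continuous_integrable; exact: cst_continuous.
  exact: rintegrable_norm (integrable_ln p q w).
apply: continuous_integrable => t.
apply: cvgD; first exact: cvg_cst.
apply: (@continuous_comp _ _ _ (fun t => w - t) (fun v => v ^+ 2));
  last exact: exprn_continuous.
by apply: cvgB => //; exact: cvg_cst.
Qed.

(** Stated with the variable [w - t], since the logarithm is evaluated at
    differences. *)
Lemma by_parts (A a : R -> R) w p q (Q : {poly R}) : p <= q ->
  continuous A ->
  (forall v, v != 0 -> is_derive v (1 : R) A (a v)) ->
  (forall v, v != 0 -> {for v, continuous a}) ->
  mu.-integrable `[p, q] (EFin \o (fun t => a (w - t))) ->
  \int[mu]_(t in `[p, q]) (A (w - t) * (Q^`()).[t]) =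
  A (w - q) * Q.[q] - A (w - p) * Q.[p]
  + \int[mu]_(t in `[p, q]) (a (w - t) * Q.[t]).
Proof.
move=> pq cA dA ca ia.
have i1 : mu.-integrable `[p, q] (EFin \o (fun t => A (w - t) * (Q^`()).[t])).
  apply: continuous_integrable => t; apply: cvgM; last exact: continuous_horner.
  by apply: continuous_comp_csub; exact: cA.
have i2 : mu.-integrable `[p, q] (EFin \o (fun t => a (w - t) * Q.[t])).
  by apply: integrable_mul_continuous => //; exact: continuous_horner.
apply/eqP; rewrite -subr_eq -RintegralB //; apply/eqP.
apply: (@Rintegral_FTC_except _ (fun t => A (w - t) * Q.[t]) p q w) => //.
- exact: rintegrableB.
- move=> t; apply: cvgM; last exact: continuous_horner.
  by apply: continuous_comp_csub; exact: cA.
- move=> t tw; have wt : w - t != 0 by rewrite subr_eq0 eq_sym.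
  apply: cvgB; (apply: cvgM; last exact: continuous_horner).
    by apply: continuous_comp_csub; exact: cA.
  by apply: continuous_comp_csub; exact: ca.
- move=> t tw; have wt : w - t != 0 by rewrite subr_eq0 eq_sym.
  have d0 : is_derive t (1 : R) (fun t => w - t) (-1).
    by apply: trigger_derive; rewrite add0r mul1r.
  have d1 := @is_derive1_comp R A (fun t => w - t) t _ _ (dA _ wt) d0.
  have d2 := is_derive_poly Q t.
  apply: (trigger_derive (is_deriveM d1 d2)).
  by rewrite /GRing.scale /=; ring.
Qed.

Lemma by_parts_radial k c w p q (Q : {poly R}) : p <= q ->
  \int[mu]_(t in `[p, q]) (zlog_radial k c (w - t) * (Q^`()).[t]) =
  zlog_radial k c (w - q) * Q.[q] - zlog_radial k c (w - p) * Q.[p]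
  + \int[mu]_(t in `[p, q]) ((ln_modulus c (w - t) + 1) * Q.[t]).
Proof.
move=> pq; apply: (by_parts (a := fun v => ln_modulus c v + 1)) => //.
- exact: continuous_zlog_radial.
- by move=> v v0; exact: is_derive_zlog_radial.
- move=> v v0; apply: cvgD; last exact: cvg_cst.
  by apply: continuous_ln_modulus; rewrite v0 orbT.
- apply: rintegrableD => //; first exact: integrable_ln_modulus.
  by apply: continuous_integrable; exact: cst_continuous.
Qed.

Lemma by_parts_angular k c w p q (Q : {poly R}) : p <= q ->
  \int[mu]_(t in `[p, q]) (zlog_angular k c (w - t) * (Q^`()).[t]) =
  zlog_angular k c (w - q) * Q.[q] - zlog_angular k c (w - p) * Q.[p]
  + \int[mu]_(t in `[p, q]) (- branch_arg k c (w - t) * Q.[t]).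
Proof.
move=> pq; apply: (by_parts (a := fun v => - branch_arg k c v)) => //.
- exact: continuous_zlog_angular.
- by move=> v v0; exact: is_derive_zlog_angular.
- by move=> v v0; apply: cvgN; exact: continuous_branch_arg.
- apply: continuous_integrable => t; apply: cvgN.
  by apply: continuous_comp_csub; exact: continuous_branch_arg.
Qed.

End Improper.

(** * The argument along horizontal and vertical lines *)

Section Argument.
Variable R : realType.
Local Notation mu := (@lebesgue_measure R).
Implicit Types (a b v x y : R).

Lemma sin_atan v : sin (atan v) = v / Num.sqrt (1 + v ^+ 2).
Proof.
have c0 : cos (atan v) != 0.
  by rewrite cos_atan invr_neq0 // sqrtr_eq0 -ltNge ltr_wpDr ?sqr_ge0.
by rewrite -cos_atan -{2}(atanK v) /tan divfK.
Qed.

Lemma sqrt_scale v (c : R) : 0 < c ->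
  c * Num.sqrt (1 + v ^+ 2) = Num.sqrt (c ^+ 2 + (c * v) ^+ 2).
Proof.
move=> c0; rewrite -{1}(gtr0_norm c0) -sqrtr_sqr -sqrtrM ?sqr_ge0 //.
by rewrite mulrDr mulr1 exprMn.
Qed.

Lemma acos_eq (t u : R) : 0 <= t <= pi -> cos t = u -> acos u = t.
Proof. by move=> tpi <-; rewrite cosK // in_itv. Qed.

Lemma acos_right a b : 0 < a -> acos (a / Num.sqrt (a ^+ 2 + b ^+ 2)) = atan (`|b| / a).
Proof.
move=> a0; have ba : 0 <= `|b| / a by rewrite divr_ge0 // ltW.
apply: acos_eq.
  have := atan_ltpi2 (`|b| / a); have := le_atan ba; rewrite atan0.
  have := @pi_gt0 R; move=> *; apply/andP; split; lra.
rewrite cos_atan -[in RHS](real_normK (num_real b)).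
have -> : Num.sqrt (a ^+ 2 + `|b| ^+ 2) = a * Num.sqrt (1 + (`|b| / a) ^+ 2).
  by rewrite sqrt_scale // mulrC divfK // gt_eqF.
by rewrite invfM mulrA divff ?gt_eqF // mul1r.
Qed.

(** This form of the argument is smooth in [a], the one of [acos_right] and
    [acos_left] is smooth in [b]. *)
Lemma acos_off_axis a b : b != 0 ->
  acos (a / Num.sqrt (a ^+ 2 + b ^+ 2)) = pi / 2 - atan (a / `|b|).
Proof.
move=> b0; have nb : 0 < `|b| by rewrite normr_gt0.
apply: acos_eq.
  have := atan_ltpi2 (a / `|b|); have := atan_gtNpi2 (a / `|b|).
  by move=> *; apply/andP; split; lra.
rewrite cosB cos_pihalf sin_pihalf mul0r mul1r add0r sin_atan.
have -> : Num.sqrt (a ^+ 2 + b ^+ 2) = `|b| * Num.sqrt (1 + (a / `|b|) ^+ 2).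
  by rewrite sqrt_scale // mulrC divfK ?gt_eqF // real_normK ?num_real // addrC.
by rewrite invfM mulrA.
Qed.

Lemma acos_left a b : a < 0 -> acos (a / Num.sqrt (a ^+ 2 + b ^+ 2)) = pi + atan (`|b| / a).
Proof.
move=> a0; have an0 : 0 < - a by rewrite oppr_gt0.
have r0 : 0 < a ^+ 2 + b ^+ 2 by rewrite ltr_wpDr ?sqr_ge0 // exprn_even_gt0 //= lt_eqF.
have s0 : 0 < Num.sqrt (a ^+ 2 + b ^+ 2) by rewrite sqrtr_gt0.
have na : `|a / Num.sqrt (a ^+ 2 + b ^+ 2)| <= 1.
  rewrite normrM normfV (gtr0_norm s0) ler_pdivrMr // mul1r -sqrtr_sqr.
  by rewrite ler_wsqrtr // lerDl sqr_ge0.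
have := acos_right b an0; rewrite sqrrN mulNr acosN; last by rewrite -ler_norml.
by rewrite invrN mulrN atanN => H; lra.
Qed.

(** The argument as [b] decreases to zero, with [pi / 2] on the imaginary axis. *)
Definition axis_arg a : R := if a < 0 then pi else if a == 0 then pi / 2 else 0.

Lemma carg_vertical a b :
  carg (a +i* b) = branch_arg (if 0 <= b then axis_arg a else - axis_arg a) a b.
Proof.
rewrite /carg /branch_arg /axis_arg /=.
have [a0|a0|->] := ltgtP a 0.
- rewrite acos_left //; case: ifPn => [b0|]; first by rewrite ger0_norm.
  by rewrite -ltNge => b0; rewrite ltr0_norm // opprD mulNr atanN opprK.
- rewrite acos_right //; case: ifPn => [b0|]; first by rewrite ger0_norm // add0r.
  by rewrite -ltNge => b0; rewrite ltr0_norm // mulNr atanN opprK oppr0 add0r.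
- by rewrite mul0r acos0 invr0 mulr0 atan0 !addr0.
Qed.

Lemma carg_horizontal a b : b != 0 ->
  carg (a +i* b) = - branch_arg (if 0 <= b then - (pi / 2) else pi / 2) b a.
Proof.
move=> b0; rewrite /carg /branch_arg /= acos_off_axis //.
case: ifPn => [bge|]; first by rewrite ger0_norm // opprD opprK.
by rewrite -ltNge => blt; rewrite ltr0_norm // invrN mulrN atanN opprK.
Qed.

(** The constant is not sharp; any bound gives integrability. *)
Lemma norm_carg a b : `|carg (a +i* b)| <= 2 * pi.
Proof.
rewrite carg_vertical /branch_arg /axis_arg.
have h1 := atan_ltpi2 (b / a); have h2 := atan_gtNpi2 (b / a); have p0 := @pi_gt0 R.
by rewrite ler_norml; apply/andP; split; case: ifP => _; case: ifP => _; try case: ifP => _;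
  lra.
Qed.

(** Continuity off the origin suffices. *)
Lemma measurable_invr : measurable_fun setT (fun v : R => v^-1).
Proof.
rewrite (_ : (fun v => _) = fun v : R => if v == 0 then 0 else v^-1); last first.
  by apply/funext => v; case: eqP => // ->; rewrite invr0.
apply: measurable_fun_if => //.
- exact: measurable_fun_eqr.
- rewrite setTI (_ : _ @^-1` _ = ~` [set 0]); last first.
    by apply/seteqP; split => v /=; [move/eqP|move/eqP/negbTE].
  apply: open_continuous_measurable_fun; first exact/closed_openC/closed_eq.
  by move=> v /[!inE] /eqP v0; exact: inv_continuous.
Qed.

Lemma measurable_carg : measurable_fun setT (fun p : R * R => carg (p.1 +i* p.2)).
Proof.
rewrite (_ : (fun p => _) = fun p : R * R => (if 0 <= p.2 then axis_arg p.1 else - axis_arg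
  p.1) + atan (p.2 * p.1^-1)); last first.
  by apply/funext => p; rewrite carg_vertical.
have mx : measurable_fun setT (@axis_arg : R -> R).
  apply: measurable_fun_ifT => //; first exact: measurable_fun_ltr.
  by apply: measurable_fun_ifT => //; exact: measurable_fun_eqr.
have mx1 : measurable_fun setT (fun p : R * R => axis_arg p.1).
  by apply: measurableT_comp.
apply: measurable_funD.
  apply: measurable_fun_ifT => //.
    by apply: measurable_fun_ler.
  exact: measurableT_comp.
apply: measurableT_comp; first by apply: continuous_measurable_fun => v; exact: continuous_atan.
apply: measurable_funM => //.
by apply: measurableT_comp => //; exact: measurable_invr.
Qed.

Lemma measurable_ln_modulus2 : measurable_fun setT (fun p : R * R => ln_modulus p.1 p.2).
Proof.
apply: measurableT_comp; first exact: measurable_ln.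
apply: measurableT_comp; first by apply: continuous_measurable_fun => v; exact: sqrt_continuous.
by apply: measurable_funD; apply: measurable_funX.
Qed.

End Argument.

(** * Integration by parts across a jump *)

Section Slices.
Variable R : realType.
Local Notation mu := (@lebesgue_measure R).
Implicit Types (f g : R -> R) (p q w c x y : R).

Lemma Rintegral_split f p c q : p <= c <= q ->
  mu.-integrable `[p, q] (EFin \o f) ->
  \int[mu]_(t in `[p, q]) f t =
  \int[mu]_(t in `[p, c]) f t + \int[mu]_(t in `[c, q]) f t.
Proof.
move=> /andP[pc cq] intf.
have := @Rintegral_itvB _ f (BLeft p) (BRight q) c intf.
rewrite !bnd_simp => /(_ pc cq).
rewrite Rintegral_itv_obnd_cbnd; first by move=> <-; rewrite addrC subrK.
by apply: integrableS intf => //; apply: subset_itv; rewrite bnd_simp.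
Qed.

Lemma eq_Rintegral_oo f g p q :
  mu.-integrable `[p, q] (EFin \o f) -> mu.-integrable `[p, q] (EFin \o g) ->
  (forall t, p < t < q -> f t = g t) ->
  \int[mu]_(t in `[p, q]) f t = \int[mu]_(t in `[p, q]) g t.
Proof.
move=> intf intg fg.
have oo h : mu.-integrable `[p, q] (EFin \o h) ->
    \int[mu]_(t in `[p, q]) h t = \int[mu]_(t in `]p, q[) h t.
  move=> inth; rewrite Rintegral_itv_bndo_bndc; last first.
    by apply: integrableS inth => //; exact: subset_itv_oo_cc.
  rewrite Rintegral_itv_obnd_cbnd //.
  by apply: integrableS inth => //; exact: subset_itv_oc_cc.
rewrite !oo //; apply: eq_Rintegral => t; rewrite inE /= in_itv/=; exact: fg.
Qed.

Lemma integrable_carg (u v : R -> R) p q : measurable_fun setT u -> measurable_fun setT v ->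
  mu.-integrable `[p, q] (EFin \o (fun t => carg (u t +i* v t))).
Proof.
move=> mu_ mv; apply: (@rintegrable_le _ _ _ mu _ _ _ (cst (2 * pi))) => //.
- apply: measurable_funTS.
  apply: (@measurableT_comp _ _ _ _ _ _ _ _ (fun t => (u t, v t)) (@measurable_carg R)).
  exact: measurable_fun_pair.
- by move=> t _; exact: norm_carg.
- by apply: continuous_integrable; exact: cst_continuous.
Qed.

(** The function [F] follows one branch on the left of [w] and another one on
    the right.  The splitting point [c] is [w] if it lies in the interval and an
    end of the interval otherwise, in which case one of the branches is not met. *)
Lemma by_parts_split (A1 a1 A2 a2 F f : R -> R) w p c q (Q : {poly R}) :
  p <= c <= q -> (forall t, p < t < c -> t < w) -> (forall t, c < t < q -> w < t) ->
  (continuous A1) -> (continuous A2) ->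
  (forall v, v != 0 -> is_derive v (1 : R) A1 (a1 v)) ->
  (forall v, v != 0 -> is_derive v (1 : R) A2 (a2 v)) ->
  (forall v, v != 0 -> {for v, continuous a1}) ->
  (forall v, v != 0 -> {for v, continuous a2}) ->
  mu.-integrable `[p, q] (EFin \o (fun t => a1 (w - t))) ->
  mu.-integrable `[p, q] (EFin \o (fun t => a2 (w - t))) ->
  mu.-integrable `[p, q] (EFin \o (fun t => F (w - t))) ->
  mu.-integrable `[p, q] (EFin \o (fun t => f (w - t))) ->
  (forall v, 0 < v -> F v = A1 v /\ f v = a1 v) ->
  (forall v, v < 0 -> F v = A2 v /\ f v = a2 v) ->
  \int[mu]_(t in `[p, q]) (F (w - t) * (Q^`()).[t]) =
  (A1 (w - c) * Q.[c] - A1 (w - p) * Q.[p]) + (A2 (w - q) * Q.[q] - A2 (w - c) * Q.[c])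
  + \int[mu]_(t in `[p, q]) (f (w - t) * Q.[t]).
Proof.
move=> pcq tw wt cA1 cA2 dA1 dA2 ca1 ca2 ia1 ia2 iF jf H1 H2.
have /andP[pc cq] := pcq.
have s1 : `[p, c] `<=` `[p, q] by apply: subset_itv; rewrite bnd_simp.
have s2 : `[c, q] `<=` `[p, q] by apply: subset_itv; rewrite bnd_simp.
have sub1 h : mu.-integrable `[p, q] (EFin \o h) -> mu.-integrable `[p, c] (EFin \o h).
  by move=> ih; apply: integrableS ih.
have sub2 h : mu.-integrable `[p, q] (EFin \o h) -> mu.-integrable `[c, q] (EFin \o h).
  by move=> ih; apply: integrableS ih.
have mulQ (P : {poly R}) h r s : mu.-integrable `[r, s] (EFin \o h) ->
    mu.-integrable `[r, s] (EFin \o (fun t => h t * P.[t])).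
  by move=> ih; apply: integrable_mul_continuous => //; exact: continuous_horner.
have iA (A : R -> R) r s : continuous A -> mu.-integrable `[r, s]
  (EFin \o (fun t => A (w - t))).
  move=> cA; apply: continuous_integrable => t. exact: (@continuous_comp_csub _ A w t (cA _)).
rewrite (@Rintegral_split (fun t => F (w - t) * _) p c q) //; last exact: mulQ.
rewrite (@Rintegral_split (fun t => f (w - t) * _) p c q) //; last exact: mulQ.
rewrite (@eq_Rintegral_oo (fun t => F (w - t) * _) (fun t => A1 (w - t) * (Q^`()).[t]) p c);
  last 3 first.
- by apply: mulQ; exact: sub1.
- by apply: mulQ; exact: iA.
- by move=> t /tw t_w; rewrite (H1 _ _).1 // subr_gt0.
rewrite (@eq_Rintegral_oo (fun t => F (w - t) * _) (fun t => A2 (w - t) * (Q^`()).[t]) c q);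
  last 3 first.
- by apply: mulQ; exact: sub2.
- by apply: mulQ; exact: iA.
- by move=> t /wt w_t; rewrite (H2 _ _).1 // subr_lt0.
rewrite (@eq_Rintegral_oo (fun t => f (w - t) * _) (fun t => a1 (w - t) * Q.[t]) p c);
  last 3 first.
- by apply: mulQ; exact: sub1.
- by apply: mulQ; exact: sub1.
- by move=> t /tw t_w; rewrite (H1 _ _).2 // subr_gt0.
rewrite (@eq_Rintegral_oo (fun t => f (w - t) * _) (fun t => a2 (w - t) * Q.[t]) c q);
  last 3 first.
- by apply: mulQ; exact: sub2.
- by apply: mulQ; exact: sub2.
- by move=> t /wt w_t; rewrite (H2 _ _).2 // subr_lt0.
rewrite (by_parts Q pc cA1 dA1 ca1 (sub1 _ ia1)) (by_parts Q cq cA2 dA2 ca2 (sub2 _ ia2)).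
ring.
Qed.

End Slices.

(** * Real and imaginary parts of u log u along the two axes *)

Section LogPrimitives.
Variable R : realType.
Local Notation mu := (@lebesgue_measure R).
Implicit Types (a b v w x y s t : R).

Definition re_zlog a b : R := a * ln_modulus a b - b * carg (a +i* b).
Definition im_zlog a b : R := a * carg (a +i* b) + b * ln_modulus a b.
Definition carg_minus (z : R[i]) : R := complex.Im (clog_minus z).

Lemma carg_upper a b : 0 <= b -> carg (a +i* b) = branch_arg (axis_arg a) a b.
Proof. by move=> b0; rewrite carg_vertical b0. Qed.

Lemma carg_lower a b : b < 0 -> carg (a +i* b) = branch_arg (- axis_arg a) a b.
Proof. by move=> b0; rewrite carg_vertical leNgt b0. Qed.

Lemma carg_minus_off a b : b != 0 -> carg_minus (a +i* b) = carg (a +i* b).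
Proof. by move=> b0; rewrite /carg_minus /clog_minus /= (negbTE b0). Qed.

(** The factor [a] makes the choice of the argument at the origin harmless. *)
Lemma carg_minus_lower a b : b <= 0 ->
  a * carg_minus (a +i* b) = a * branch_arg (- axis_arg a) a b.
Proof.
rewrite le_eqVlt => /predU1P[->|b0]; last by rewrite carg_minus_off ?lt_eqF // carg_lower.
rewrite /carg_minus /clog_minus /= eqxx /= /branch_arg mul0r atan0 addr0.
case: ifPn => [a0|]; first by rewrite /axis_arg a0.
rewrite -leNgt => a0; rewrite /= carg_upper // /branch_arg mul0r atan0 addr0.
rewrite /axis_arg ltNge a0 /=; case: eqP => [->|]; first by rewrite !mul0r.
by rewrite oppr0.
Qed.

Lemma re_zlog_upper x v : 0 <= v -> re_zlog x v = zlog_angular (axis_arg x) x v.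
Proof. by move=> v0; rewrite /re_zlog carg_upper. Qed.

Lemma re_zlog_lower x v : v <= 0 -> re_zlog x v = zlog_angular (- axis_arg x) x v.
Proof.
rewrite le_eqVlt /re_zlog /zlog_angular => /predU1P[->|v0]; first by rewrite !mul0r.
by rewrite carg_lower.
Qed.

Lemma im_zlog_upper x v : 0 <= v -> im_zlog x v = zlog_radial (axis_arg x) x v.
Proof. by move=> v0; rewrite /im_zlog carg_upper // /zlog_radial addrC. Qed.

Lemma im_zlog_lower x v : v < 0 -> im_zlog x v = zlog_radial (- axis_arg x) x v.
Proof. by move=> v0; rewrite /im_zlog carg_lower // /zlog_radial addrC. Qed.

Lemma im_zlog_minus_lower x v : v <= 0 ->
  x * carg_minus (x +i* v) + v * ln_modulus x v = zlog_radial (- axis_arg x) x v.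
Proof. by move=> v0; rewrite carg_minus_lower // /zlog_radial addrC. Qed.

Lemma measurable_csub w : measurable_fun setT (fun t : R => w - t).
Proof. by apply: continuous_measurable_fun => t; apply: cvgB => //; exact: cvg_cst. Qed.

Lemma integrable_carg_h y w p q : mu.-integrable `[p, q]
  (EFin \o (fun t => carg ((w - t) +i* y))).
Proof. by apply: integrable_carg => //; exact: measurable_csub. Qed.

Lemma integrable_carg_v x w p q : mu.-integrable `[p, q]
  (EFin \o (fun t => carg (x +i* (w - t)))).
Proof. by apply: integrable_carg => //; exact: measurable_csub. Qed.

Lemma integrable_ln_modulus_h y w p q : mu.-integrable `[p, q]
  (EFin \o (fun t => ln_modulus (w - t) y)).
Proof.
by apply: (rintegrable_eq _ _ (integrable_ln_modulus y p q w)) => // t _; rewrite ln_modulusC.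
Qed.

Lemma continuous_csub w : continuous (fun t : R => w - t).
Proof. by move=> t; apply: cvgB => //; exact: cvg_cst. Qed.

(** On the axis [b = 0] the argument is multiplied by zero, so that no case
    distinction on the side of the cut is needed. *)
Lemma re_zlog_horizontal a b :
  re_zlog a b = zlog_radial (if 0 <= b then - (pi / 2) else pi / 2) b a.
Proof.
rewrite /re_zlog /zlog_radial ln_modulusC; have [->|b0] := eqVneq b 0;
  first by rewrite !mul0r subr0 addr0.
by rewrite carg_horizontal // mulrN opprK.
Qed.

Lemma im_zlog_horizontal a b : b != 0 ->
  im_zlog a b = zlog_angular (if 0 <= b then - (pi / 2) else pi / 2) b a.
Proof.
by move=> b0; rewrite /im_zlog /zlog_angular ln_modulusC carg_horizontal // mulrN addrC.
Qed.

Lemma re_zlog_by_parts_h x y (Q : {poly R}) :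
  \int[mu]_(s in `[-1, 1]) (re_zlog (x - s) y * (Q^`()).[s]) =
  re_zlog (x - 1) y * Q.[1] - re_zlog (x + 1) y * Q.[-1]
  + \int[mu]_(s in `[-1, 1]) ((ln_modulus (x - s) y + 1) * Q.[s]).
Proof.
have := @by_parts_radial R (if 0 <= y then - (pi / 2) else pi / 2) y x (-1) 1 Q.
rewrite opprK -!re_zlog_horizontal => H.
transitivity (\int[mu]_(t in `[-1, 1]) (zlog_radial (if 0 <= y then - (pi / 2) else pi / 2) y
  (x - t) * Q^`().[t])).
  by apply: eq_Rintegral => s _; rewrite re_zlog_horizontal.
rewrite H; last by lra.
by congr (_ + _); apply: eq_Rintegral => s _; rewrite ln_modulusC.
Qed.

Lemma clamp_exists y : exists c,
  [/\ -1 <= c <= 1, forall t, -1 < t < c -> t < y, forall t, c < t < 1 -> y < t &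
    [\/ 1 <= y /\ c = 1, y <= -1 /\ c = -1 | -1 < y < 1 /\ c = y]].
Proof.
have [y1|y1] := leP 1 y.
  exists 1; split; last by constructor 1.
  - by apply/andP; split; lra.
  - by move=> t /andP[h1 h2]; apply: lt_le_trans y1.
  - by move=> t /andP[h1 h2]; have := lt_trans h1 h2; rewrite ltxx.
have [y2|y2] := leP y (-1).
  exists (-1); split; last by constructor 2.
  - by apply/andP; split; lra.
  - by move=> t /andP[h1 h2]; have := lt_trans h1 h2; rewrite ltxx.
  - by move=> t /andP[h1 h2]; apply: le_lt_trans h1.
exists y; split; [apply/andP; split; lra|by move=> t /andP[]|by move=> t /andP[]|].
by constructor 3; split=> //; apply/andP.
Qed.

Lemma im_zlog_axis v : im_zlog v 0 = if v < 0 then pi * v else 0.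
Proof.
rewrite /im_zlog mul0r addr0 carg_upper // /branch_arg mul0r atan0 addr0 /axis_arg.
case: ltgtP => [| |->]; rewrite ?mulr0 ?mul0r //.
by rewrite mulrC.
Qed.

(** On the real axis the argument is a step function of the position; the
    product with the position is still continuous, so no jump appears. *)
Lemma im_zlog_by_parts_h x y (Q : {poly R}) :
  \int[mu]_(s in `[-1, 1]) (im_zlog (x - s) y * (Q^`()).[s]) =
  im_zlog (x - 1) y * Q.[1] - im_zlog (x + 1) y * Q.[-1]
  + \int[mu]_(s in `[-1, 1]) (carg ((x - s) +i* y) * Q.[s]).
Proof.
have [->|y0] := eqVneq y 0; last first.
  have := @by_parts_angular R (if 0 <= y then - (pi / 2) else pi / 2) y x (-1) 1 Q.
  rewrite opprK -!im_zlog_horizontal // => H.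
  transitivity (\int[mu]_(t in `[-1, 1]) (zlog_angular (if 0 <= y then - (pi / 2) else pi / 2)
    y (x - t) * Q^`().[t])).
    by apply: eq_Rintegral => s _; rewrite im_zlog_horizontal.
  rewrite H; last by lra.
  by congr (_ + _); apply: eq_Rintegral => s _; rewrite carg_horizontal.
have [c [c1 tc ct cc]] := clamp_exists x.
etransitivity.
  (* argument 0 to the right of the origin, pi to the left *)
  apply: (@by_parts_split R (cst 0) (cst 0) (fun v => pi * v) (cst pi)
  (fun v => im_zlog v 0) (fun v => carg (v +i* 0)) x (-1) c 1) => //.
  - exact: cst_continuous.
  - by move=> v; apply: cvgM => //; exact: cvg_cst.
  - by move=> v v0; apply: trigger_derive; rewrite /GRing.scale /=; ring.
  - by move=> v v0; exact: cst_continuous.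
  - by move=> v v0; exact: cst_continuous.
  - by apply: continuous_integrable; exact: cst_continuous.
  - by apply: continuous_integrable; exact: cst_continuous.
  - apply: rintegrableD => //.
      apply: (@rintegrable_eq _ _ _ mu _ _ (fun t => carg ((x - t) +i* 0) * (x - t))) => //.
        by move=> t _; rewrite mulrC.
      by apply: integrable_mul_continuous; [exact: continuous_csub|exact: integrable_carg_h].
    by apply: rintegrableZ => //; exact: integrable_ln_modulus_h.
  - exact: integrable_carg_h.
  - move=> v v0; rewrite im_zlog_axis ltNge (ltW v0) /=; split=> //.
    by rewrite carg_upper // /branch_arg mul0r atan0 addr0 /axis_arg ltNge (ltW v0) /= gt_eqF.
  - move=> v v0; rewrite im_zlog_axis v0 /=; split=> //.
    by rewrite carg_upper // /branch_arg mul0r atan0 addr0 /axis_arg v0.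
rewrite opprK !im_zlog_axis /=; congr (_ + _).
case: cc => [[x1 ->]|[x1 ->]|[/andP[x1 x2] ->]].
+ by rewrite ifF ?ifF; [ring|apply/negbTE; rewrite -leNgt; lra..].
+ have [x2|x2] := ltP (x + 1) 0; first by rewrite ifT; [ring|lra].
  have -> : x = -1 by lra.
  by rewrite ifT; [ring|lra].
+ by rewrite ifT ?ifF; [ring|apply/negbTE; rewrite -leNgt; lra|lra].
Qed.

(** At the crossing of the cut the argument jumps, but it is multiplied by [b = 0]. *)
Lemma re_zlog_by_parts_v x y (Q : {poly R}) :
  \int[mu]_(t in `[-1, 1]) (re_zlog x (y - t) * (Q^`()).[t]) =
  re_zlog x (y - 1) * Q.[1] - re_zlog x (y + 1) * Q.[-1]
  + \int[mu]_(t in `[-1, 1]) (- carg (x +i* (y - t)) * Q.[t]).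
Proof.
have [c [c1 tc ct cc]] := clamp_exists y.
etransitivity.
  apply: (@by_parts_split R (zlog_angular (axis_arg x) x)
    (fun v => - branch_arg (axis_arg x) x v)
    (zlog_angular (- axis_arg x) x) (fun v => - branch_arg (- axis_arg x) x v)
  (re_zlog x) (fun v => - carg (x +i* v)) y (-1) c 1) => //.
  - exact: continuous_zlog_angular.
  - exact: continuous_zlog_angular.
  - by move=> v v0; exact: is_derive_zlog_angular.
  - by move=> v v0; exact: is_derive_zlog_angular.
  - by move=> v v0; apply: cvgN; exact: continuous_branch_arg.
  - by move=> v v0; apply: cvgN; exact: continuous_branch_arg.
  - by apply: continuous_integrable => t; apply: cvgN; apply: continuous_comp_csub;
    exact: continuous_branch_arg.
  - by apply: continuous_integrable => t; apply: cvgN; apply: continuous_comp_csub;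
    exact: continuous_branch_arg.
  - apply: rintegrableB => //; first by apply: rintegrableZ => //; exact: integrable_ln_modulus.
    apply: (@rintegrable_eq _ _ _ mu _ _ (fun t => carg (x +i* (y - t)) * (y - t))) => //.
      by move=> t _; rewrite mulrC.
    by apply: integrable_mul_continuous; [exact: continuous_csub|exact: integrable_carg_v].
  - apply: (@rintegrable_eq _ _ _ mu _ _ (fun t => -1 * carg (x +i* (y - t)))) => //.
      by move=> t _; rewrite mulN1r.
    by apply: rintegrableZ => //; exact: integrable_carg_v.
  - by move=> v v0; rewrite re_zlog_upper ?ltW // carg_upper ?ltW.
  - by move=> v v0; rewrite re_zlog_lower ?ltW // carg_lower.
rewrite opprK; congr (_ + _).
case: cc => [[y1 ->]|[y1 ->]|[/andP[y1 y2] ->]].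
+ by rewrite !re_zlog_upper; [ring|lra..].
+ by rewrite opprK !re_zlog_lower; [ring|lra..].
+ have e : zlog_angular (axis_arg x) x 0 = zlog_angular (- axis_arg x) x 0.
    by rewrite /zlog_angular !mul0r.
  rewrite subrr e (re_zlog_lower x (_ : y - 1 <= 0)); last by lra.
  by rewrite (re_zlog_upper x (_ : 0 <= y + 1)); [ring|lra].
Qed.

(** Here the jump of the argument is multiplied by [x]: this is where the
    conditional term comes from, and where the lower end of the segment needs
    the argument taken from below. *)
Lemma im_zlog_by_parts_v x y (Q : {poly R}) :
  \int[mu]_(t in `[-1, 1]) (im_zlog x (y - t) * (Q^`()).[t]) =
  im_zlog x (y - 1) * Q.[1]
  - (x * carg_minus (x +i* (y + 1)) + (y + 1) * ln_modulus x (y + 1)) * Q.[-1]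
  + (if (x < 0) && (-1 < y < 1) then 2 * pi * x * Q.[y] else 0)
  + \int[mu]_(t in `[-1, 1]) ((ln_modulus x (y - t) + 1) * Q.[t]).
Proof.
have [c [c1 tc ct cc]] := clamp_exists y.
have up v : 0 < v -> x * carg_minus (x +i* v) + v * ln_modulus x v = zlog_radial (axis_arg x) x
  v.
  by move=> v0; rewrite carg_minus_off ?gt_eqF // -im_zlog_upper // ltW.
etransitivity.
  apply: (@by_parts_split R (zlog_radial (axis_arg x) x) (fun v => ln_modulus x v + 1)
  (zlog_radial (- axis_arg x) x) (fun v => ln_modulus x v + 1)
  (im_zlog x) (fun v => ln_modulus x v + 1) y (-1) c 1) => //.
  - exact: continuous_zlog_radial.
  - exact: continuous_zlog_radial.
  - by move=> v v0; exact: is_derive_zlog_radial.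
  - by move=> v v0; exact: is_derive_zlog_radial.
  - by move=> v v0; apply: cvgD; [apply: continuous_ln_modulus; rewrite v0 orbT|exact: cvg_cst].
  - by move=> v v0; apply: cvgD; [apply: continuous_ln_modulus; rewrite v0 orbT|exact: cvg_cst].
  - by apply: rintegrableD => //; [exact: integrable_ln_modulus|apply: continuous_integrable;
    exact: cst_continuous].
  - by apply: rintegrableD => //; [exact: integrable_ln_modulus|apply: continuous_integrable;
    exact: cst_continuous].
  - apply: rintegrableD => //; first by apply: rintegrableZ => //; exact: integrable_carg_v.
    apply: (@rintegrable_eq _ _ _ mu _ _ (fun t => ln_modulus x (y - t) * (y - t))) => //.
      by move=> t _; rewrite mulrC.
    by apply: integrable_mul_continuous; [exact: continuous_csub|exact: integrable_ln_modulus].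
  - by apply: rintegrableD => //; [exact: integrable_ln_modulus|apply: continuous_integrable;
    exact: cst_continuous].
  - by move=> v v0; rewrite im_zlog_upper ?ltW.
  - by move=> v v0; rewrite im_zlog_lower.
rewrite opprK; congr (_ + _).
case: cc => [[y1 ->]|[y1 ->]|[/andP[y1 y2] ->]].
+ rewrite (im_zlog_upper x (_ : 0 <= y - 1)) ?subr_ge0 // up; last by lra.
  by rewrite ifF; [ring|rewrite [y < 1]ltNge y1 !andbF].
+ rewrite opprK (im_zlog_lower x (_ : y - 1 < 0)) ?im_zlog_minus_lower; [|lra|lra].
  by rewrite ifF; [ring|rewrite [-1 < y]ltNge y1 andbF].
+ rewrite subrr up ?im_zlog_lower; [|lra|lra].
  have e : zlog_radial (axis_arg x) x 0 = zlog_radial (- axis_arg x) x 0 +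
    (if x < 0 then 2 * pi * x else 0).
    rewrite /zlog_radial !mul0r !add0r /branch_arg mul0r atan0 !addr0 /axis_arg.
    by case: ltgtP => [x0|x0|->]; ring.
  by rewrite e y1 y2 !andbT; case: ifP => _; ring.
Qed.

End LogPrimitives.

(** * Complex-valued integrals *)

Section ComplexIntegral.
Context d (T : measurableType d) (R : realType).
Variables (m : {measure set T -> \bar R}) (D : set T).
Hypothesis mD : measurable D.
Implicit Types (f g : T -> R[i]) (c : R[i]).

Local Notation Re := (@complex.Re R).
Local Notation Im := (@complex.Im R).

Definition cintegrable f :=
  m.-integrable D (EFin \o (fun t => Re (f t))) /\
  m.-integrable D (EFin \o (fun t => Im (f t))).

(** The multipliers that preserve integrability. *)
Definition cbounded_measurable g :=
  [/\ measurable_fun D (fun t => Re (g t)), measurable_fun D (fun t => Im (g t)),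
    [bounded Re (g t) | t in D] & [bounded Im (g t) | t in D]].

Lemma complexReM (u v : R[i]) : Re (u * v) = Re u * Re v - Im u * Im v.
Proof. by case: u => a b; case: v => a' b'. Qed.

Lemma complexImM (u v : R[i]) : Im (u * v) = Re u * Im v + Im u * Re v.
Proof. by case: u => a b; case: v => a' b'. Qed.

Lemma complexReD (u v : R[i]) : Re (u + v) = Re u + Re v.
Proof. by case: u => a b; case: v => a' b'. Qed.

Lemma complexImD (u v : R[i]) : Im (u + v) = Im u + Im v.
Proof. by case: u => a b; case: v => a' b'. Qed.

Lemma complexReN (u : R[i]) : Re (- u) = - Re u.
Proof. by case: u. Qed.

Lemma complexImN (u : R[i]) : Im (- u) = - Im u.
Proof. by case: u. Qed.

Lemma complex_ext (u v : R[i]) : Re u = Re v -> Im u = Im v -> u = v.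
Proof. by case: u => a b; case: v => a' b' /= -> ->. Qed.

Lemma eq_cintegral f g : (forall t, D t -> f t = g t) ->
  cintegral m D f = cintegral m D g.
Proof.
by move=> fg; rewrite /cintegral; congr (_ +i* _); apply: eq_Rintegral => t; rewrite inE => Dt;
  rewrite fg.
Qed.

Lemma cintegrable_eq f g : (forall t, D t -> f t = g t) -> cintegrable f -> cintegrable g.
Proof.
by move=> fg [h1 h2]; split; [apply: rintegrable_eq h1|apply: rintegrable_eq h2] => // t Dt;
  rewrite fg.
Qed.

Lemma cintegrableD f g : cintegrable f -> cintegrable g ->
  cintegrable (fun t => f t + g t).
Proof.
move=> [f1 f2] [g1 g2]; split.
  by apply: (rintegrable_eq mD _ (rintegrableD mD f1 g1)) => t _; rewrite complexReD.
by apply: (rintegrable_eq mD _ (rintegrableD mD f2 g2)) => t _; rewrite complexImD.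
Qed.

Lemma cintegralD f g : cintegrable f -> cintegrable g ->
  cintegral m D (fun t => f t + g t) = cintegral m D f + cintegral m D g.
Proof.
move=> [f1 f2] [g1 g2]; apply: complex_ext; rewrite ?complexReD ?complexImD /=.
  by rewrite -RintegralD //; apply: eq_Rintegral => t _; rewrite complexReD.
by rewrite -RintegralD //; apply: eq_Rintegral => t _; rewrite complexImD.
Qed.

Lemma cintegrableZ c f : cintegrable f -> cintegrable (fun t => c * f t).
Proof.
move=> [f1 f2]; split.
  by apply: (rintegrable_eq mD _ (rintegrableB mD (rintegrableZ mD (Re c) f1)
    (rintegrableZ mD (Im c) f2))) => t _; rewrite complexReM.
by apply: (rintegrable_eq mD _ (rintegrableD mD (rintegrableZ mD (Re c) f2)
  (rintegrableZ mD (Im c) f1))) => t _; rewrite complexImM.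
Qed.

Lemma cintegralZ c f : cintegrable f ->
  cintegral m D (fun t => c * f t) = c * cintegral m D f.
Proof.
move=> [f1 f2]; apply: complex_ext; rewrite ?complexReM ?complexImM /=.
  rewrite -!RintegralZl // -RintegralB //; [|exact: rintegrableZ..].
  by apply: eq_Rintegral => t _; rewrite complexReM.
rewrite -!RintegralZl // -RintegralD //; [|exact: rintegrableZ..].
by apply: eq_Rintegral => t _; rewrite complexImM.
Qed.

Lemma cintegrable_axpy c f g : cintegrable f -> cintegrable g ->
  cintegrable (fun t => c * f t + g t).
Proof. by move=> intf intg; apply: cintegrableD => //; exact: cintegrableZ. Qed.

Lemma cintegral_axpy c f g : cintegrable f -> cintegrable g ->
  cintegral m D (fun t => c * f t + g t) = c * cintegral m D f + cintegral m D g.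
Proof.
by move=> intf intg; rewrite cintegralD ?cintegralZ //; exact: cintegrableZ.
Qed.

Lemma cintegrableM f g : cintegrable f -> cbounded_measurable g ->
  cintegrable (fun t => f t * g t).
Proof.
move=> [f1 f2] [mg1 mg2 bg1 bg2]; split.
  by apply: (rintegrable_eq mD _ (rintegrableB mD (rintegrableM mD f1 mg1 bg1)
    (rintegrableM mD f2 mg2 bg2))) => t _; rewrite complexReM.
by apply: (rintegrable_eq mD _ (rintegrableD mD (rintegrableM mD f1 mg2 bg2)
  (rintegrableM mD f2 mg1 bg1))) => t _; rewrite complexImM.
Qed.

End ComplexIntegral.

(** * Iterated integrals over the square *)

Section ComplexFubini.
Variable R : realType.
Local Notation mu := (@lebesgue_measure R).
Local Notation mu2 := (mu \x mu)%E.
Local Notation Re := (@complex.Re R).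
Local Notation Im := (@complex.Im R).

Lemma measurable_Omega : @measurable _ (measurableTypeR R * measurableTypeR R)%type (@Omega R).
Proof. exact: measurableX. Qed.

(** By Tonelli applied to the absolute value. *)
Lemma integrable_inner_fst (f : measurableTypeR R * measurableTypeR R -> \bar R) :
  mu2.-integrable setT f -> mu.-integrable setT (fubini_G mu f).
Proof.
move=> intf; have mf := measurable_int _ intf.
apply/integrableP; split; first exact: (measurable_fubini_G intf).
apply: le_lt_trans ((integrable21ltyP _ _ mf).1 intf).
apply: ge0_le_integral => //.
- by apply: measurableT_comp => //; exact: (measurable_fubini_G intf).
- apply: (measurable_fun_fubini_tonelli_G (abse \o f)).
    exact: measurableT_comp.
  by move=> p; exact: abse_ge0.
- move=> y _; apply: le_abse_integral => //.
  exact: measurableT_comp.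
Qed.

Section real.
Variable g : R * R -> R.
Hypothesis ig : mu2.-integrable (@Omega R) (EFin \o g).

Let h := (EFin \o g) \_ (@Omega R).
Let ih : mu2.-integrable setT h.
Proof. by apply/(integrable_mkcond _ measurable_Omega). Qed.

Let patch1 s : (fun t => h (s, t)) = (if -1 <= s <= 1 then (EFin \o (fun t => g (s, t))) \_
  `[-1, 1] else cst 0%E).
Proof.
apply/funext => t; rewrite /h patchE /Omega in_setX !mem_setE !in_itv/=.
by have [s1|s1] := boolP (-1 <= s <= 1); rewrite //= patchE mem_setE in_itv.
Qed.

Let patch2 t : (fun s => h (s, t)) = (if -1 <= t <= 1 then (EFin \o (fun s => g (s, t))) \_
  `[-1, 1] else cst 0%E).
Proof.
apply/funext => s; rewrite /h patchE /Omega in_setX !mem_setE !in_itv/=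
  [X in if X then _ else _]andbC.
by have [t1|t1] := boolP (-1 <= t <= 1); rewrite //= patchE mem_setE in_itv.
Qed.

(** Every slice has to be integrable, not only almost every one, for the inner
    integral to be the finite part of the extended-real one everywhere. *)
Lemma Rintegral_fubini1 :
  (forall s, -1 <= s <= 1 -> mu.-integrable `[-1, 1] (EFin \o (fun t => g (s, t)))) ->
  mu.-integrable `[-1, 1] (EFin \o (fun s => \int[mu]_(t in `[-1, 1]) g (s, t))) /\
  \int[mu2]_(p in @Omega R) g p =
  \int[mu]_(s in `[-1, 1]) \int[mu]_(t in `[-1, 1]) g (s, t).
Proof.
move=> gs.
have FE s : s \in `[-1, 1]%classic -> fubini_F mu h s = (\int[mu]_(t in `[-1, 1]) g (s, t))%:E.
  rewrite inE /= in_itv/= => s1.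
  rewrite /fubini_F /Rintegral fineK; last exact: integrable_fin_num (gs s s1).
  by rewrite patch1 s1 [RHS]integral_mkcond.
have F0 s : s \notin `[-1, 1]%classic -> fubini_F mu h s = 0%E.
  rewrite mem_setE in_itv/= => /negbTE s1.
  by rewrite /fubini_F patch1 s1 integral0.
have FP : fubini_F mu h = (EFin \o (fun s => \int[mu]_(t in `[-1, 1]) g (s, t))) \_ `[-1, 1].
  by apply/funext => s; rewrite patchE; case: ifPn => [/FE|/F0].
split.
  apply/integrable_mkcond => //.
  by rewrite -FP; exact: integrable_fubini_F.
rewrite {1}/Rintegral integral_mkcond -/h -integral12_prod_meas1 //.
rewrite -[LHS]/(fine (\int[mu]_x fubini_F mu h x)%E) FP.
by rewrite -integral_mkcond.
Qed.

Lemma Rintegral_fubini2 :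
  (forall t, -1 <= t <= 1 -> mu.-integrable `[-1, 1] (EFin \o (fun s => g (s, t)))) ->
  mu.-integrable `[-1, 1] (EFin \o (fun t => \int[mu]_(s in `[-1, 1]) g (s, t))) /\
  \int[mu2]_(p in @Omega R) g p =
  \int[mu]_(t in `[-1, 1]) \int[mu]_(s in `[-1, 1]) g (s, t).
Proof.
move=> gt.
have GE t : t \in `[-1, 1]%classic -> fubini_G mu h t = (\int[mu]_(s in `[-1, 1]) g (s, t))%:E.
  rewrite inE /= in_itv/= => t1.
  rewrite /fubini_G /Rintegral fineK; last exact: integrable_fin_num (gt t t1).
  by rewrite patch2 t1 [RHS]integral_mkcond.
have G0 t : t \notin `[-1, 1]%classic -> fubini_G mu h t = 0%E.
  rewrite mem_setE in_itv/= => /negbTE t1.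
  by rewrite /fubini_G patch2 t1 integral0.
have GP : fubini_G mu h = (EFin \o (fun t => \int[mu]_(s in `[-1, 1]) g (s, t))) \_ `[-1, 1].
  by apply/funext => t; rewrite patchE; case: ifPn => [/GE|/G0].
split.
  apply/integrable_mkcond => //.
  by rewrite -GP; exact: integrable_inner_fst.
rewrite {1}/Rintegral integral_mkcond -/h -integral21_prod_meas1 //.
rewrite -[LHS]/(fine (\int[mu]_x fubini_G mu h x)%E) GP.
by rewrite -integral_mkcond.
Qed.

End real.

Lemma cintegral_fubini1 (g : R * R -> R[i]) :
  cintegrable mu2 (@Omega R) g ->
  (forall s, -1 <= s <= 1 -> cintegrable mu `[-1, 1] (fun t => g (s, t))) ->
  cintegrable mu `[-1, 1] (fun s => cintegral mu `[-1, 1] (fun t => g (s, t))) /\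
  cintegral mu2 (@Omega R) g =
  cintegral mu `[-1, 1] (fun s => cintegral mu `[-1, 1] (fun t => g (s, t))).
Proof.
move=> [g1 g2] gs.
have [i1 e1] := Rintegral_fubini1 g1 (fun s s1 => (gs s s1).1).
have [i2 e2] := Rintegral_fubini1 g2 (fun s s1 => (gs s s1).2).
by split; [split|rewrite /cintegral e1 e2].
Qed.

Lemma cintegral_fubini2 (g : R * R -> R[i]) :
  cintegrable mu2 (@Omega R) g ->
  (forall t, -1 <= t <= 1 -> cintegrable mu `[-1, 1] (fun s => g (s, t))) ->
  cintegrable mu `[-1, 1] (fun t => cintegral mu `[-1, 1] (fun s => g (s, t))) /\
  cintegral mu2 (@Omega R) g =
  cintegral mu `[-1, 1] (fun t => cintegral mu `[-1, 1] (fun s => g (s, t))).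
Proof.
move=> [g1 g2] gt.
have [i1 e1] := Rintegral_fubini2 g1 (fun t t1 => (gt t t1).1).
have [i2 e2] := Rintegral_fubini2 g2 (fun t t1 => (gt t t1).2).
by split; [split|rewrite /cintegral e1 e2].
Qed.

End ComplexFubini.

(** * The integrals of u log u on horizontal and vertical segments *)

Section LogIntegrals.
Variable R : realType.
Local Notation mu := (@lebesgue_measure R).
Local Notation mu2 := (mu \x mu)%E.
Local Notation I := (`[-1, 1]%classic : set R).
Implicit Types (w z : R[i]) (p q P Q : {poly R}).

Local Notation Re := (@complex.Re R).
Local Notation Im := (@complex.Im R).

Definition zlog (u : R[i]) : R[i] := u * clog u.
Definition zlog_minus (u : R[i]) : R[i] := u * clog_minus u.

Definition log_hmoment p w : R[i] :=
  cintegral mu I (fun t : R => clog (w - t%:C) * (p.[t])%:C).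
Definition log_vmoment p w : R[i] :=
  cintegral mu I (fun t : R => clog (w - 'i%C * t%:C) * (p.[t])%:C).
Definition log_moment2 p q z : R[i] :=
  cintegral mu2 (@Omega R) (fun a : R * R =>
    clog (z - (a.1 +i* a.2)) * (p.[a.1] * q.[a.2])%:C).
Definition poly_integral p : R := \int[mu]_(t in I) p.[t].

Lemma complexBr (x y t : R) : (x +i* y) - t%:C = (x - t) +i* y.
Proof. by apply: complex_ext => //=; rewrite subr0. Qed.

Lemma complexBi (x y t : R) : (x +i* y) - 'i%C * t%:C = x +i* (y - t).
Proof. by apply: complex_ext => /=; ring. Qed.

Lemma complexReMr (u : R[i]) (a : R) : Re (u * a%:C) = Re u * a.
Proof. by rewrite complexReM /= mulr0 subr0. Qed.

Lemma complexImMr (u : R[i]) (a : R) : Im (u * a%:C) = Im u * a.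
Proof. by rewrite complexImM /= mulr0 add0r. Qed.

Lemma Re_zlog (a b : R) : Re (zlog (a +i* b)) = re_zlog a b.
Proof. by rewrite /zlog complexReM. Qed.

Lemma Im_zlog (a b : R) : Im (zlog (a +i* b)) = im_zlog a b.
Proof. by rewrite /zlog complexImM. Qed.

Lemma Re_zlog_minus (a b : R) : Re (zlog_minus (a +i* b)) = re_zlog a b.
Proof.
rewrite /zlog_minus complexReM /clog_minus /=; case: ifP => [/andP[/eqP -> _]|_] /=.
  by rewrite /re_zlog !mul0r.
by [].
Qed.

Lemma Im_zlog_minus (a b : R) :
  Im (zlog_minus (a +i* b)) = a * carg_minus (a +i* b) + b * ln_modulus a b.
Proof. by rewrite /zlog_minus complexImM /carg_minus /clog_minus /=; case: ifP => _ /=. Qed.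

Lemma bounded_horner p : [bounded p.[t] | t in I].
Proof.
have cp : {within I, continuous (fun t => p.[t])}.
  by apply: continuous_subspaceT => t; exact: continuous_horner.
have /compact_bounded[M [_ mrt]] := continuous_compact cp (@segment_compact _ (-1) 1).
exists M; split; first by rewrite num_real.
by move=> r Mr t tI; apply: (mrt r Mr); exists t.
Qed.

Lemma measurable_horner p : measurable_fun setT (fun t : R => p.[t]).
Proof. by apply: continuous_measurable_fun => t; exact: continuous_horner. Qed.

Lemma bounded_cst (d : measure_display) (T : measurableType d) (D : set T) (c : R) :
  [bounded c | _ in D].
Proof. by exists `|c|; split; [exact: num_real|move=> M /ltW h t _]. Qed.

Lemma cbounded_horner p : cbounded_measurable I (fun t : R => (p.[t])%:C).
Proof.
split=> /=.
- by apply: measurable_funTS; exact: measurable_horner.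
- exact: measurable_cst.
- exact: bounded_horner.
- exact: bounded_cst.
Qed.

Lemma cintegrable_clog_h w p :
  cintegrable mu I (fun t : R => clog (w - t%:C) * (p.[t])%:C).
Proof.
apply: cintegrableM => //; last exact: cbounded_horner.
case: w => x y; split.
  by apply: (rintegrable_eq _ _ (integrable_ln_modulus_h y x (-1) 1)) => // t _;
    rewrite complexBr.
by apply: (rintegrable_eq _ _ (integrable_carg_h y x (-1) 1)) => // t _; rewrite complexBr.
Qed.

Lemma cintegrable_clog_v w p :
  cintegrable mu I (fun t : R => clog (w - 'i%C * t%:C) * (p.[t])%:C).
Proof.
apply: cintegrableM => //; last exact: cbounded_horner.
case: w => x y; split.
  by apply: (rintegrable_eq _ _ (integrable_ln_modulus x (-1) 1 y)) => // t _;
    rewrite complexBi.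
by apply: (rintegrable_eq _ _ (integrable_carg_v x y (-1) 1)) => // t _; rewrite complexBi.
Qed.

Lemma cintegrable_zlog_h w p :
  cintegrable mu I (fun t : R => zlog (w - t%:C) * (p.[t])%:C).
Proof.
apply: (cintegrable_eq _ _ (cintegrableD _ (cintegrableZ _ w (cintegrable_clog_h w p))
  (cintegrableZ _ (-1) (cintegrable_clog_h w ('X * p))))) => // t _.
by rewrite /zlog hornerM hornerX rmorphM /=; ring.
Qed.

Lemma cintegrable_zlog_v w p :
  cintegrable mu I (fun t : R => zlog (w - 'i%C * t%:C) * (p.[t])%:C).
Proof.
apply: (cintegrable_eq _ _ (cintegrableD _ (cintegrableZ _ w (cintegrable_clog_v w p))
  (cintegrableZ _ (- 'i%C) (cintegrable_clog_v w ('X * p))))) => // t _.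
by rewrite /zlog hornerM hornerX rmorphM /=; ring.
Qed.

Lemma integrable_horner p : mu.-integrable I (EFin \o (fun t => p.[t])).
Proof. by apply: continuous_integrable; exact: continuous_horner. Qed.

Lemma cintegral_realM (f : R -> R[i]) (g : R -> R) :
  cintegral mu I (fun t => f t * (g t)%:C) =
  (\int[mu]_(t in I) (Re (f t) * g t)) +i* (\int[mu]_(t in I) (Im (f t) * g t)).
Proof.
by rewrite /cintegral; congr (_ +i* _); apply: eq_Rintegral => t _;
  rewrite ?complexReMr ?complexImMr.
Qed.

Lemma zlog_by_parts_h w Q :
  cintegral mu I (fun t => zlog (w - t%:C) * ((Q^`()).[t])%:C) =
  zlog (w - 1) * (Q.[1])%:C - zlog (w + 1) * (Q.[-1])%:C + log_hmoment Q w +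
    (poly_integral Q)%:C.
Proof.
case: w => x y.
have -> : x +i* y - 1 = (x - 1) +i* y by rewrite -complexBr.
have -> : x +i* y + 1 = (x + 1) +i* y by apply: complex_ext => //=; rewrite addr0.
rewrite cintegral_realM /log_hmoment cintegral_realM.
have eRe : \int[mu]_(t in I) (Re (zlog (x +i* y - t%:C)) * (Q^`()).[t]) =
    \int[mu]_(s in I) (re_zlog (x - s) y * (Q^`()).[s]).
  by apply: eq_Rintegral => t _; rewrite complexBr Re_zlog.
have eIm : \int[mu]_(t in I) (Im (zlog (x +i* y - t%:C)) * (Q^`()).[t]) =
    \int[mu]_(s in I) (im_zlog (x - s) y * (Q^`()).[s]).
  by apply: eq_Rintegral => t _; rewrite complexBr Im_zlog.
have fRe : \int[mu]_(t in I) (Re (clog (x +i* y - t%:C)) * Q.[t]) =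
    \int[mu]_(s in I) (ln_modulus (x - s) y * Q.[s]).
  by apply: eq_Rintegral => t _; rewrite complexBr.
have fIm : \int[mu]_(t in I) (Im (clog (x +i* y - t%:C)) * Q.[t]) =
    \int[mu]_(s in I) (carg ((x - s) +i* y) * Q.[s]).
  by apply: eq_Rintegral => t _; rewrite complexBr.
have split1 : \int[mu]_(s in I) ((ln_modulus (x - s) y + 1) * Q.[s]) =
    \int[mu]_(s in I) (ln_modulus (x - s) y * Q.[s]) + poly_integral Q.
  rewrite /poly_integral -RintegralD; last 3 first.
  - exact: measurable_itv.
  - by apply: integrable_mul_continuous; [exact: continuous_horner|exact:
    integrable_ln_modulus_h].
  - exact: integrable_horner.
  by apply: eq_Rintegral => t _; rewrite mulrDl mul1r.
rewrite eRe eIm fRe fIm re_zlog_by_parts_h im_zlog_by_parts_h split1.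
apply: complex_ext.
  by rewrite !complexReD complexReN !complexReMr !Re_zlog /= addrA.
by rewrite !complexImD complexImN !complexImMr !Im_zlog /= addr0.
Qed.

(** The jump of [u log u] at the crossing, times the value of [P] there. *)
Definition cut_jump P w : R[i] :=
  if (Re w < 0) && (-1 < Im w < 1) then 2 * 'i%C * (pi * Re w * P.[Im w])%:C else 0.

Lemma zlog_by_parts_v w Q :
  cintegral mu I (fun t => zlog (w - 'i%C * t%:C) * ((Q^`()).[t])%:C) =
  zlog (w - 'i%C) * (Q.[1])%:C - zlog_minus (w + 'i%C) * (Q.[-1])%:C + cut_jump Q w
  + 'i%C * log_vmoment Q w + 'i%C * (poly_integral Q)%:C.
Proof.
case: w => x y.
have -> : x +i* y - 'i%C = x +i* (y - 1) by apply: complex_ext => //=; rewrite subr0.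
have -> : x +i* y + 'i%C = x +i* (y + 1) by apply: complex_ext => //=; rewrite addr0.
rewrite cintegral_realM /log_vmoment cintegral_realM.
have eRe : \int[mu]_(t in I) (Re (zlog (x +i* y - 'i%C * t%:C)) * (Q^`()).[t]) =
    \int[mu]_(t in I) (re_zlog x (y - t) * (Q^`()).[t]).
  by apply: eq_Rintegral => t _; rewrite complexBi Re_zlog.
have eIm : \int[mu]_(t in I) (Im (zlog (x +i* y - 'i%C * t%:C)) * (Q^`()).[t]) =
    \int[mu]_(t in I) (im_zlog x (y - t) * (Q^`()).[t]).
  by apply: eq_Rintegral => t _; rewrite complexBi Im_zlog.
have fRe : \int[mu]_(t in I) (Re (clog (x +i* y - 'i%C * t%:C)) * Q.[t]) =
    \int[mu]_(t in I) (ln_modulus x (y - t) * Q.[t]).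
  by apply: eq_Rintegral => t _; rewrite complexBi.
have fIm : \int[mu]_(t in I) (Im (clog (x +i* y - 'i%C * t%:C)) * Q.[t]) =
    \int[mu]_(t in I) (carg (x +i* (y - t)) * Q.[t]).
  by apply: eq_Rintegral => t _; rewrite complexBi.
have split1 : \int[mu]_(t in I) ((ln_modulus x (y - t) + 1) * Q.[t]) =
    \int[mu]_(t in I) (ln_modulus x (y - t) * Q.[t]) + poly_integral Q.
  rewrite /poly_integral -RintegralD; last 3 first.
  - exact: measurable_itv.
  - by apply: integrable_mul_continuous; [exact: continuous_horner|exact:
    integrable_ln_modulus].
  - exact: integrable_horner.
  by apply: eq_Rintegral => t _; rewrite mulrDl mul1r.
have neg : \int[mu]_(t in I) (- carg (x +i* (y - t)) * Q.[t]) =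
    - \int[mu]_(t in I) (carg (x +i* (y - t)) * Q.[t]).
  rewrite -[RHS]mulN1r -RintegralZl; last 2 first.
  - exact: measurable_itv.
  - by apply: integrable_mul_continuous; [exact: continuous_horner|exact: integrable_carg_v].
  by apply: eq_Rintegral => t _; rewrite mulNr mulN1r.
rewrite eRe eIm fRe fIm re_zlog_by_parts_v im_zlog_by_parts_v split1 neg.
have cutRe : Re (cut_jump Q (x +i* y)) = 0.
  by rewrite /cut_jump; case: ifP => // _; rewrite complexReMr complexReM /=; ring.
have cutIm : Im (cut_jump Q (x +i* y)) = if (x < 0) && (-1 < y < 1) then 2 * pi * x * Q.[y]
  else 0.
  by rewrite /cut_jump; case: ifP => // _; rewrite complexImMr complexImM /=; ring.
apply: complex_ext.
  rewrite !complexReD complexReN !complexReMr Re_zlog Re_zlog_minus cutRe !complexReM /=; ring.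
rewrite !complexImD complexImN !complexImMr Im_zlog Im_zlog_minus cutIm !complexImM /=; ring.
Qed.

End LogIntegrals.

(** * The double integral of u log u *)

Section DoubleIntegrals.
Variable R : realType.
Local Notation mu := (@lebesgue_measure R).
Local Notation mu2 := (mu \x mu)%E.
Local Notation I := (`[-1, 1]%classic : set R).
Implicit Types (w z : R[i]) (p q P Q : {poly R}).

Local Notation Re := (@complex.Re R).
Local Notation Im := (@complex.Im R).

Section coordinate.
Variable phi : R -> R.
Hypothesis mphi : measurable_fun setT phi.
Hypothesis iphi : mu.-integrable I (EFin \o phi).

Let inner (x : R) : (\int[mu]_(t in I) `|(phi x)%:E|)%E = (2 * `|phi x|)%:E.
Proof.
rewrite integral_cst //= lebesgue_measure_itv /= lte_fin ifT; last by lra.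
by rewrite -EFinB -EFinM mulrC opprK.
Qed.

Let outer : (\int[mu]_(s in I) (2 * `|phi s|)%:E < +oo)%E.
Proof.
have /integrableP[_] : mu.-integrable I (EFin \o (fun s => 2 * `|phi s|)).
  by apply: rintegrableZ => //; exact: rintegrable_norm.
apply: le_lt_trans; apply: ge0_le_integral => //.
- by apply/measurable_EFinP; apply: measurable_funTS; apply: measurable_funM => //;
  exact: measurableT_comp.
- apply/measurable_EFinP; apply: measurable_funTS; apply: measurableT_comp => //.
  by apply: measurable_funM => //; exact: measurableT_comp.
- by move=> s _; rewrite lee_fin ler_norm.
Qed.

(** With [integrable_snd], this reduces integrability over the square to one
    variable. *)
Lemma integrable_fst : mu2.-integrable (@Omega R) (EFin \o (fun a => phi a.1)).
Proof.
have mh : measurable_fun (setT : set (measurableTypeR R * measurableTypeR R)%type)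
    ((EFin \o (fun a => phi a.1)) \_ (@Omega R)).
  have mO := @measurable_Omega R.
  apply/(measurable_restrictT _ mO).
  by apply/measurable_EFinP; apply: measurable_funTS; exact: measurableT_comp.
apply/(integrable_mkcond _ (@measurable_Omega R)). apply: (integrable12ltyP _ _ mh).2.
apply: le_lt_trans outer; rewrite [leRHS]integral_mkcond.
rewrite le_eqVlt; apply/orP; left; apply/eqP; apply: eq_integral => x _.
rewrite patchE; case: ifPn => xI.
  rewrite -inner [RHS]integral_mkcond; apply: eq_integral => y _.
  by rewrite !patchE /Omega in_setX xI /=; case: ifP => // _; exact: abse0.
rewrite -[RHS](integral0 mu setT); apply: eq_integral => y _.
by rewrite patchE /Omega in_setX (negbTE xI) /=; exact: abse0.
Qed.

Lemma integrable_snd : mu2.-integrable (@Omega R) (EFin \o (fun a => phi a.2)).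
Proof.
have mh : measurable_fun (setT : set (measurableTypeR R * measurableTypeR R)%type)
    ((EFin \o (fun a => phi a.2)) \_ (@Omega R)).
  have mO := @measurable_Omega R.
  apply/(measurable_restrictT _ mO).
  by apply/measurable_EFinP; apply: measurable_funTS; exact: measurableT_comp.
apply/(integrable_mkcond _ (@measurable_Omega R)); apply: (integrable21ltyP _ _ mh).2.
apply: le_lt_trans outer; rewrite [leRHS]integral_mkcond.
rewrite le_eqVlt; apply/orP; left; apply/eqP; apply: eq_integral => x _.
rewrite patchE; case: ifPn => xI.
  rewrite -inner [RHS]integral_mkcond; apply: eq_integral => y _.
  by rewrite !patchE /Omega in_setX xI andbT /=; case: ifP => // _; exact: abse0.
rewrite -[RHS](integral0 mu setT); apply: eq_integral => y _.
by rewrite patchE /Omega in_setX (negbTE xI) andbF /=; exact: abse0.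
Qed.

End coordinate.

Lemma integrable_Omega_cst (c : R) : mu2.-integrable (@Omega R) (EFin \o (fun=> c)).
Proof.
apply: (@integrable_fst (cst c)); first exact: measurable_cst.
by apply: continuous_integrable; exact: cst_continuous.
Qed.

Lemma cbounded_fst p : cbounded_measurable (@Omega R) (fun a : R * R => (p.[a.1])%:C).
Proof.
split=> /=.
- by apply: measurable_funTS; apply: measurableT_comp => //; exact: measurable_horner.
- exact: measurable_cst.
- have [M [Mr bM]] := bounded_horner p; exists M; split => // r Mr' [s t] [/= sI tI].
  exact: (bM r Mr' s sI).
- exact: bounded_cst.
Qed.

Lemma cbounded_snd p : cbounded_measurable (@Omega R) (fun a : R * R => (p.[a.2])%:C).
Proof.
split=> /=.
- by apply: measurable_funTS; apply: measurableT_comp => //; exact: measurable_horner.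
- exact: measurable_cst.
- have [M [Mr bM]] := bounded_horner p; exists M; split => // r Mr' [s t] [/= sI tI].
  exact: (bM r Mr' t tI).
- exact: bounded_cst.
Qed.

(** The logarithm of the modulus is dominated by a sum of functions of one
    variable each, and the argument is bounded. *)
Lemma cintegrable_clog2 z p q :
  cintegrable mu2 (@Omega R) (fun a : R * R =>
    clog (z - (a.1 +i* a.2)) * (p.[a.1] * q.[a.2])%:C).
Proof.
have mO := @measurable_Omega R.
suff H : cintegrable mu2 (@Omega R) (fun a : R * R => clog (z - (a.1 +i* a.2))).
  apply: (cintegrable_eq mO _ (cintegrableM mO (cintegrableM mO H (cbounded_fst p))
    (cbounded_snd q))) => a _.
  by rewrite rmorphM mulrA.
case: z => x y.
have m1 : measurable_fun (setT : set (measurableTypeR R * measurableTypeR R)%type)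
    (fun a => (x - a.1, y - a.2)).
  by apply: measurable_fun_pair; apply: measurable_funB.
split.
  apply: (@rintegrable_le _ _ _ mu2 _ mO _ (fun a : R * R =>
    (`|ln `|x - a.1| | + `|ln `|y - a.2| |) + (1 + (x - a.1) ^+ 2 + (y - a.2) ^+ 2))).
  - apply: measurable_funTS.
    exact: (measurableT_comp (@measurable_ln_modulus2 R) m1).
  - by move=> a _; exact: norm_ln_modulus_le.
  - have mln (r : R) : measurable_fun setT (fun t : R => `|ln `|r - t| |).
      apply: measurableT_comp => //; apply: measurableT_comp; first exact: measurable_ln.
      by apply: measurableT_comp => //; exact: measurable_csub.
    have msq (r : R) : measurable_fun setT (fun t : R => (r - t) ^+ 2).
      by apply: measurable_funX; exact: measurable_csub.
    have isq (r : R) : mu.-integrable I (EFin \o (fun t => (r - t) ^+ 2)).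
      apply: continuous_integrable => t; apply: (@continuous_comp_csub R (fun v => v ^+ 2)).
      exact: exprn_continuous.
    have iln (r : R) := rintegrable_norm (integrable_ln (-1) 1 r).
    apply: rintegrableD => //; first apply: rintegrableD => //.
    + exact: (@integrable_fst (fun s => `|ln `|x - s| |)).
    + exact: (@integrable_snd (fun s => `|ln `|y - s| |)).
    + apply: rintegrableD => //; first apply: rintegrableD => //.
      * exact: integrable_Omega_cst.
      * exact: (@integrable_fst (fun s => (x - s) ^+ 2)).
      * exact: (@integrable_snd (fun s => (y - s) ^+ 2)).
apply: (@rintegrable_le _ _ _ mu2 _ mO _ (fun=> 2 * pi)).
- apply: measurable_funTS.
  exact: (measurableT_comp (@measurable_carg R) m1).
- by move=> a _; exact: norm_carg.
- exact: integrable_Omega_cst.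
Qed.

Lemma measurable_I : @measurable _ (measurableTypeR R) I.
Proof. exact: measurable_itv. Qed.

Definition zlog_hmoment p w : R[i] :=
  cintegral mu I (fun t : R => zlog (w - t%:C) * (p.[t])%:C).
Definition zlog_vmoment p w : R[i] :=
  cintegral mu I (fun t : R => zlog (w - 'i%C * t%:C) * (p.[t])%:C).
Definition zlog_moment2 p q z : R[i] :=
  cintegral mu2 (@Omega R) (fun a : R * R =>
    zlog (z - (a.1 +i* a.2)) * (p.[a.1] * q.[a.2])%:C).

Lemma complex_split (s t : R) : s +i* t = s%:C + 'i%C * t%:C.
Proof. by apply: complex_ext => /=; ring. Qed.

(** One substitutes [s + i t = z - u]. *)
Lemma zlog2_split z p q (s t : R) :
  zlog (z - (s +i* t)) * (p.[s] * q.[t])%:C =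
  z * (clog (z - (s +i* t)) * (p.[s] * q.[t])%:C)
  + (-1 * (clog (z - (s +i* t)) * (('X * p).[s] * q.[t])%:C)
  + - 'i%C * (clog (z - (s +i* t)) * (p.[s] * ('X * q).[t])%:C)).
Proof.
rewrite /zlog !hornerM !hornerX !rmorphM /=; set c := clog _.
by rewrite complex_split; ring.
Qed.

Lemma cintegrable_zlog2 z p q :
  cintegrable mu2 (@Omega R) (fun a : R * R =>
    zlog (z - (a.1 +i* a.2)) * (p.[a.1] * q.[a.2])%:C).
Proof.
have mO := @measurable_Omega R.
have i1 := cintegrableZ mO z (cintegrable_clog2 z p q).
have i2 := cintegrableZ mO (-1) (cintegrable_clog2 z ('X * p) q).
have i3 := cintegrableZ mO (- 'i%C) (cintegrable_clog2 z p ('X * q)).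
apply: (cintegrable_eq mO _ (cintegrableD mO i1 (cintegrableD mO i2 i3))) => a _.
by rewrite -zlog2_split.
Qed.

Lemma log_moment2_mul_z z p q :
  z * log_moment2 p q z = log_moment2 ('X * p) q z + 'i%C * log_moment2 p ('X * q) z +
    zlog_moment2 p q z.
Proof.
have mO := @measurable_Omega R.
have i1 := cintegrableZ mO z (cintegrable_clog2 z p q).
have i2 := cintegrableZ mO (-1) (cintegrable_clog2 z ('X * p) q).
have i3 := cintegrableZ mO (- 'i%C) (cintegrable_clog2 z p ('X * q)).
have -> : zlog_moment2 p q z = z * log_moment2 p q z +
  (-1 * log_moment2 ('X * p) q z + - 'i%C * log_moment2 p ('X * q) z).
  rewrite /log_moment2 -(cintegralZ mO z (cintegrable_clog2 z p q)).
  rewrite -(cintegralZ mO _ (cintegrable_clog2 z ('X * p) q))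
    -(cintegralZ mO _ (cintegrable_clog2 z p ('X * q))).
  rewrite -(cintegralD mO i2 i3) -(cintegralD mO i1 (cintegrableD mO i2 i3)).
  by apply: eq_cintegral => a _; rewrite zlog2_split.
by ring.
Qed.

Lemma slice_h (f : R[i] -> R[i]) z p q (s t : R) :
  f (z - (s +i* t)) * (p.[s] * q.[t])%:C =
  (q.[t])%:C * (f (z - 'i%C * t%:C - s%:C) * (p.[s])%:C).
Proof. by rewrite complex_split opprD addrA addrAC rmorphM /=; ring. Qed.

Lemma slice_v (f : R[i] -> R[i]) z p q (s t : R) :
  f (z - (s +i* t)) * (p.[s] * q.[t])%:C =
  (p.[s])%:C * (f (z - s%:C - 'i%C * t%:C) * (q.[t])%:C).
Proof. by rewrite complex_split opprD addrA rmorphM /=; ring. Qed.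

Lemma log_moment2_slices_h z p q :
  cintegrable mu I (fun t : R => (q.[t])%:C * log_hmoment p (z - 'i%C * t%:C)) /\
  log_moment2 p q z = cintegral mu I (fun t : R => (q.[t])%:C * log_hmoment p
    (z - 'i%C * t%:C)).
Proof.
have sl (t : R) : cintegral mu I (fun s : R => clog (z - (s +i* t)) * (p.[s] * q.[t])%:C) =
    (q.[t])%:C * log_hmoment p (z - 'i%C * t%:C).
  rewrite /log_hmoment -cintegralZ //; last exact: cintegrable_clog_h.
  by apply: eq_cintegral => s _; rewrite slice_h.
have [//|i1 e1] := cintegral_fubini2 (cintegrable_clog2 z p q) _.
  move=> t _ /=; apply: (cintegrable_eq _ _ (cintegrableZ _ (q.[t])%:C
    (cintegrable_clog_h (z - 'i%C * t%:C) p))) => // s _.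
  by rewrite slice_h.
split; first by apply: (cintegrable_eq _ _ i1) => // t _; rewrite /= sl.
by rewrite /log_moment2 e1; apply: eq_cintegral => t _; rewrite /= sl.
Qed.

Lemma log_moment2_slices_v z p q :
  cintegrable mu I (fun s : R => (p.[s])%:C * log_vmoment q (z - s%:C)) /\
  log_moment2 p q z = cintegral mu I (fun s : R => (p.[s])%:C * log_vmoment q (z - s%:C)).
Proof.
have sl (s : R) : cintegral mu I (fun t : R => clog (z - (s +i* t)) * (p.[s] * q.[t])%:C) =
    (p.[s])%:C * log_vmoment q (z - s%:C).
  rewrite /log_vmoment -cintegralZ //; last exact: cintegrable_clog_v.
  by apply: eq_cintegral => t _; rewrite slice_v.
have [//|i1 e1] := cintegral_fubini1 (cintegrable_clog2 z p q) _.
  move=> s _ /=; apply: (cintegrable_eq _ _ (cintegrableZ _ (p.[s])%:C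
    (cintegrable_clog_v (z - s%:C) q))) => // t _.
  by rewrite slice_v.
split; first by apply: (cintegrable_eq _ _ i1) => // s _; rewrite /= sl.
by rewrite /log_moment2 e1; apply: eq_cintegral => s _; rewrite /= sl.
Qed.

Lemma cintegral_horner p : cintegral mu I (fun t : R => (p.[t])%:C) = (poly_integral p)%:C.
Proof.
rewrite /cintegral /poly_integral; apply: complex_ext => //=.
by rewrite /Rintegral integral0_eq.
Qed.

Lemma cintegrable_horner p : cintegrable mu I (fun t : R => (p.[t])%:C).
Proof. by split; [exact: integrable_horner|apply: continuous_integrable;
  exact: cst_continuous]. Qed.

Lemma zlog_moment2_deriv_h z Q q :
  zlog_moment2 (Q^`()) q z = log_moment2 Q q z + (Q.[1])%:C * zlog_vmoment q (z - 1) -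
    (Q.[-1])%:C * zlog_vmoment q (z + 1)
  + (poly_integral Q)%:C * (poly_integral q)%:C.
Proof.
have sl (t : R) : cintegral mu I (fun s : R => zlog (z - (s +i* t)) * ((Q^`()).[s] * q.[t])%:C)
  =
    (q.[t])%:C * log_hmoment Q (z - 'i%C * t%:C)
    + ((Q.[1])%:C * (zlog (z - 1 - 'i%C * t%:C) * (q.[t])%:C)
    + (- (Q.[-1])%:C * (zlog (z + 1 - 'i%C * t%:C) * (q.[t])%:C)
    + (poly_integral Q)%:C * (q.[t])%:C)).
  transitivity ((q.[t])%:C * cintegral mu I (fun s : R => zlog (z - 'i%C * t%:C - s%:C) *
    ((Q^`()).[s])%:C)).
    rewrite -cintegralZ //; last exact: cintegrable_zlog_h.
    by apply: eq_cintegral => s _; rewrite slice_h.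
  by rewrite zlog_by_parts_h (addrAC z _ 1) (addrAC z _ (-1)); ring.
have [//|_ e1] := cintegral_fubini2 (cintegrable_zlog2 z (Q^`()) q) _.
  move=> t _ /=; apply: (cintegrable_eq _ _ (cintegrableZ _ (q.[t])%:C
    (cintegrable_zlog_h (z - 'i%C * t%:C) (Q^`())))) => // s _.
  by rewrite slice_h.
have [j1 e2] := log_moment2_slices_h z Q q.
have mI := @measurable_I.
have k1 := cintegrable_zlog_v (z - 1) q.
have k2 := cintegrable_zlog_v (z + 1) q.
have k3 := cintegrableZ mI (poly_integral Q)%:C (cintegrable_horner q).
have k23 := cintegrable_axpy mI (- (Q.[-1])%:C) k2 k3.
have k123 := cintegrable_axpy mI (Q.[1])%:C k1 k23.
have -> : zlog_moment2 (Q^`()) q z = log_moment2 Q q z + ((Q.[1])%:C * zlog_vmoment q (z - 1)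
    + (- (Q.[-1])%:C * zlog_vmoment q (z + 1) + (poly_integral Q)%:C * (poly_integral q)%:C)).
  transitivity (cintegral mu I (fun t : R => (q.[t])%:C * log_hmoment Q (z - 'i%C * t%:C)
    + ((Q.[1])%:C * (zlog (z - 1 - 'i%C * t%:C) * (q.[t])%:C)
    + (- (Q.[-1])%:C * (zlog (z + 1 - 'i%C * t%:C) * (q.[t])%:C)
    + (poly_integral Q)%:C * (q.[t])%:C)))).
    by rewrite /zlog_moment2 e1; apply: eq_cintegral => t _; exact: sl.
  etransitivity; first exact: (cintegralD mI j1 k123).
  congr (_ + _); first by rewrite -e2.
  etransitivity; first exact: (cintegral_axpy mI (Q.[1])%:C k1 k23).
  congr (_ + _).
  etransitivity; first exact: (cintegral_axpy mI (- (Q.[-1])%:C) k2 k3).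
  congr (_ + _).
  etransitivity; first exact: (cintegralZ mI (poly_integral Q)%:C (cintegrable_horner q)).
  by rewrite cintegral_horner.
by rewrite mulNr !addrA.
Qed.

(** The total of the jumps met by the vertical segments, up to a factor: the
    segment at abscissa [s] crosses the cut when [s > x]. *)
Definition ramp_moment p (x : R) : R := \int[mu]_(s in I) (Num.max (s - x) 0 * p.[s]).

Lemma continuous_ramp (x : R) : continuous (fun s : R => Num.max (s - x) 0).
Proof.
move=> s; apply: (@continuous_max _ _ (fun s : R => s - x) (fun=> 0)); last exact: cvg_cst.
by apply: cvgB => //; exact: cvg_cst.
Qed.

Lemma cintegrable_ramp p (x : R) :
  cintegrable mu I (fun s : R => (Num.max (s - x) 0 * p.[s])%:C).
Proof.
split; apply: continuous_integrable; last exact: cst_continuous.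
by move=> s; apply: cvgM; [exact: continuous_ramp|exact: continuous_horner].
Qed.

Lemma cintegral_ramp p (x : R) :
  cintegral mu I (fun s : R => (Num.max (s - x) 0 * p.[s])%:C) = (ramp_moment p x)%:C.
Proof.
rewrite /cintegral /ramp_moment; apply: complex_ext => //=.
by rewrite /Rintegral integral0_eq.
Qed.

(** The two branches differ by [2 i pi] on the negative real axis only. *)
Lemma zlog_minus_ramp (a b : R) :
  zlog_minus (a +i* b) = zlog (a +i* b)
    + 2 * 'i%C * (pi * (b == 0)%R%:R * Num.max (- a) 0)%:C.
Proof.
apply: complex_ext.
  by rewrite complexReD Re_zlog_minus Re_zlog complexReMr complexReM /=; ring.
rewrite complexImD Im_zlog_minus Im_zlog complexImMr complexImM /= /im_zlog /carg_minus
  /clog_minus /=.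
have [->|b0] := eqVneq b 0; last by rewrite /=; ring.
have [a0|a0] := ltP a 0 => /=.
  rewrite carg_upper // /branch_arg !mul0r atan0 /axis_arg a0 max_l;
    last by rewrite oppr_ge0 ltW.
  ring.
rewrite max_r ?oppr_le0 //; ring.
Qed.

Lemma cut_jump_ramp Q (a b : R) :
  cut_jump Q (a +i* b) = - (2 * 'i%C * (pi * (-1 < b < 1)%R%:R * Q.[b] * Num.max (- a) 0)%:C).
Proof.
rewrite /cut_jump /=; case: ifPn => [/andP[a0 b1]|].
  rewrite b1.
  rewrite max_l; last by rewrite oppr_ge0 ltW.
  by rewrite !rmorphM rmorphN /=; ring.
rewrite negb_and => /orP[|/negbTE ->]; last by rewrite mulr0 !mul0r mulr0 oppr0.
by rewrite -leNgt => a0; rewrite max_r ?oppr_le0 // mulr0 mulr0 oppr0.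
Qed.

(** The coefficient of [ramp_moment] collects the crossings at interior points
    of the segments and, when [Im z = -1], those at their lower ends. *)
Lemma zlog_moment2_deriv_v z p Q :
  zlog_moment2 p (Q^`()) z = 'i%C * log_moment2 p Q z + (Q.[1])%:C * zlog_hmoment p (z - 'i%C)
    - (Q.[-1])%:C * zlog_hmoment p (z + 'i%C)
  - 2 * 'i%C * (pi * ((Im z == -1)%R%:R * Q.[-1] + (-1 < Im z < 1)%R%:R * Q.[Im z]))%:C *
    (ramp_moment p (Re z))%:C
  + 'i%C * (poly_integral Q)%:C * (poly_integral p)%:C.
Proof.
have mI := @measurable_I.
set jump_coef : R[i] := - (2 * 'i%C * (pi * ((Im z == -1)%R%:R * Q.[-1]
  + (-1 < Im z < 1)%R%:R * Q.[Im z]))%:C).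
have sl (s : R) : cintegral mu I (fun t : R => zlog (z - (s +i* t)) * (p.[s] * (Q^`()).[t])%:C)
  =
    'i%C * ((p.[s])%:C * log_vmoment Q (z - s%:C))
    + ((Q.[1])%:C * (zlog (z - 'i%C - s%:C) * (p.[s])%:C)
    + (- (Q.[-1])%:C * (zlog (z + 'i%C - s%:C) * (p.[s])%:C)
    + (jump_coef * (Num.max (s - Re z) 0 * p.[s])%:C
    + 'i%C * (poly_integral Q)%:C * (p.[s])%:C))).
  transitivity ((p.[s])%:C * cintegral mu I (fun t : R => zlog (z - s%:C - 'i%C * t%:C) *
    ((Q^`()).[t])%:C)).
    rewrite -cintegralZ //; last exact: cintegrable_zlog_v.
    by apply: eq_cintegral => t _; rewrite slice_v.
  rewrite zlog_by_parts_v (addrAC z _ 'i%C) (addrAC z _ (- 'i%C)).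
  have -> : zlog_minus (z + 'i%C - s%:C) = zlog (z + 'i%C - s%:C)
      + 2 * 'i%C * (pi * (Im z == -1)%R%:R * Num.max (s - Re z) 0)%:C.
    case: z {jump_coef} => x y; rewrite (_ : x +i* y + 'i%C = x +i* (y + 1));
      last by apply: complex_ext => //=; rewrite addr0.
    by rewrite complexBr zlog_minus_ramp opprB addr_eq0.
  have -> : cut_jump Q (z - s%:C) = - (2 * 'i%C *
    (pi * (-1 < Im z < 1)%R%:R * Q.[Im z] * Num.max (s - Re z) 0)%:C).
    by case: z {jump_coef} => x y; rewrite complexBr cut_jump_ramp opprB.
  by rewrite /jump_coef !(rmorphM, rmorphD) /=; ring.
have [//|_ e1] := cintegral_fubini1 (cintegrable_zlog2 z p (Q^`())) _.
  move=> s _ /=; apply: (cintegrable_eq _ _ (cintegrableZ _ (p.[s])%:C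
    (cintegrable_zlog_v (z - s%:C) (Q^`())))) => // t _.
  by rewrite slice_v.
have [j0 e2] := log_moment2_slices_v z p Q.
have k1 := cintegrable_zlog_h (z - 'i%C) p.
have k2 := cintegrable_zlog_h (z + 'i%C) p.
have k3 := cintegrable_ramp p (Re z).
have k4 := cintegrableZ mI ('i%C * (poly_integral Q)%:C) (cintegrable_horner p).
have k34 := cintegrable_axpy mI jump_coef k3 k4.
have k234 := cintegrable_axpy mI (- (Q.[-1])%:C) k2 k34.
have k1234 := cintegrable_axpy mI (Q.[1])%:C k1 k234.
have -> : zlog_moment2 p (Q^`()) z = 'i%C * log_moment2 p Q z +
  ((Q.[1])%:C * zlog_hmoment p (z - 'i%C)
    + (- (Q.[-1])%:C * zlog_hmoment p (z + 'i%C)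
    + (jump_coef * (ramp_moment p (Re z))%:C + 'i%C * (poly_integral Q)%:C *
        (poly_integral p)%:C))).
  transitivity (cintegral mu I (fun s : R => 'i%C * ((p.[s])%:C * log_vmoment Q (z - s%:C))
    + ((Q.[1])%:C * (zlog (z - 'i%C - s%:C) * (p.[s])%:C)
    + (- (Q.[-1])%:C * (zlog (z + 'i%C - s%:C) * (p.[s])%:C)
    + (jump_coef * (Num.max (s - Re z) 0 * p.[s])%:C
    + 'i%C * (poly_integral Q)%:C * (p.[s])%:C))))).
    by rewrite /zlog_moment2 e1; apply: eq_cintegral => s _; exact: sl.
  etransitivity; first exact: (cintegral_axpy mI 'i%C j0 k1234).
  congr (_ + _); first by rewrite -e2.
  etransitivity; first exact: (cintegral_axpy mI (Q.[1])%:C k1 k234).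
  congr (_ + _).
  etransitivity; first exact: (cintegral_axpy mI (- (Q.[-1])%:C) k2 k34).
  congr (_ + _).
  etransitivity; first exact: (cintegral_axpy mI jump_coef k3 k4).
  congr (_ + _); first by rewrite cintegral_ramp.
  etransitivity; first exact: (cintegralZ mI ('i%C * (poly_integral Q)%:C)
    (cintegrable_horner p)).
  by rewrite cintegral_horner.
by rewrite /jump_coef !mulNr !addrA.
Qed.

End DoubleIntegrals.

(** * Specialization to Legendre polynomials *)

Section LinearFunctionals.
Variable R : realType.
Local Notation mu := (@lebesgue_measure R).
Local Notation mu2 := (mu \x mu)%E.
Local Notation I := (`[-1, 1]%classic : set R).
Local Notation P := (legendre R).
Local Notation Q := (legendre_prim R).
Implicit Types (w z : R[i]) (p q : {poly R}).
Local Notation Re := (@complex.Re R).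
Local Notation Im := (@complex.Im R).

Definition poly_linear (L : {poly R} -> R[i]) :=
  forall (a : R) p q, L (a *: p + q) = a%:C * L p + L q.

Lemma log_hmoment_linear w : poly_linear (fun p => log_hmoment p w).
Proof.
move=> a p q; have mI := @measurable_I R.
have i1 := cintegrable_clog_h w p; have i2 := cintegrable_clog_h w q.
rewrite /log_hmoment -(cintegralZ mI _ i1) -(cintegralD mI (cintegrableZ mI _ i1) i2).
by apply: eq_cintegral => t _; rewrite hornerD hornerZ rmorphD rmorphM /=; ring.
Qed.

Lemma log_vmoment_linear w : poly_linear (fun p => log_vmoment p w).
Proof.
move=> a p q; have mI := @measurable_I R.
have i1 := cintegrable_clog_v w p; have i2 := cintegrable_clog_v w q.
rewrite /log_vmoment -(cintegralZ mI _ i1) -(cintegralD mI (cintegrableZ mI _ i1) i2).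
by apply: eq_cintegral => t _; rewrite hornerD hornerZ rmorphD rmorphM /=; ring.
Qed.

Lemma log_moment2_linear1 q z : poly_linear (fun p => log_moment2 p q z).
Proof.
move=> a p p'; have mO := @measurable_Omega R.
have i1 := cintegrable_clog2 z p q; have i2 := cintegrable_clog2 z p' q.
rewrite /log_moment2 -(cintegralZ mO _ i1) -(cintegralD mO (cintegrableZ mO _ i1) i2).
by apply: eq_cintegral => t _; rewrite hornerD hornerZ !(rmorphD, rmorphM) /=; ring.
Qed.

Lemma log_moment2_linear2 p z : poly_linear (fun q => log_moment2 p q z).
Proof.
move=> a q q'; have mO := @measurable_Omega R.
have i1 := cintegrable_clog2 z p q; have i2 := cintegrable_clog2 z p q'.
rewrite /log_moment2 -(cintegralZ mO _ i1) -(cintegralD mO (cintegrableZ mO _ i1) i2).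
by apply: eq_cintegral => t _; rewrite hornerD hornerZ !(rmorphD, rmorphM) /=; ring.
Qed.

Lemma poly_integral_linear : poly_linear (fun p => (poly_integral p)%:C).
Proof.
move=> a p q; rewrite -rmorphM -rmorphD; congr (_%:C).
rewrite /poly_integral -RintegralZl //; last exact: integrable_horner.
rewrite -RintegralD //; last 2 first.
- by apply: rintegrableZ => //; exact: integrable_horner.
- exact: integrable_horner.
by apply: eq_Rintegral => t _; rewrite hornerD hornerZ.
Qed.

Section functional.
Variable L : {poly R} -> R[i].
Hypothesis linL : poly_linear L.

Lemma poly_linear0 : L 0 = 0.
Proof.
have := linL (-1) 0 0; rewrite scaler0 addr0 rmorphN rmorph1 => H.
by rewrite H; ring.
Qed.

Lemma poly_linearZ a p : L (a *: p) = a%:C * L p.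
Proof. by rewrite -[a *: p]addr0 linL poly_linear0 addr0. Qed.

Lemma poly_linearB p q : L (p - q) = L p - L q.
Proof. by rewrite addrC -scaleN1r linL rmorphN rmorph1; ring. Qed.

Lemma double_plus1C k : 2 * k%:R + 1 != 0 :> R[i].
Proof. by rewrite -natrM natr1 pnatr_eq0. Qed.

Lemma double_plus1CE k : ((2 * k)%:R + 1 : R)%:C = 2 * k%:R + 1.
Proof. by rewrite rmorphD rmorph1 rmorph_nat natrM. Qed.

(** Written for an arbitrary linear functional because it is applied to the
    single and double integrals alike. *)
Lemma functional_legendre_prim k :
  L (Q k) = (L (P k.+1) - pred_term (fun i => L (P i)) k) / (2 * k%:R + 1).
Proof.
case: k => [|k]; first by rewrite /= legendre1 subr0 mulr0 add0r divr1.
rewrite [Q _]/= poly_linearZ poly_linearB mulrC.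
by rewrite fmorphV -double_plus1CE.
Qed.

Lemma Xlegendre k : 'X * P k =
  ((2 * k)%:R + 1)^-1 *: ((k.+1%:R : R) *: P k.+1 + (k%:R : R) *:
    (if k is i.+1 then P i else 0)).
Proof.
have n0 := double_plus1_neq0 R k.
apply: (scalerI n0); rewrite scalerA divff // scale1r !scaler_nat.
case: k n0 => [|k] n0.
  rewrite legendre1 legendre0 muln0 add0r scale1r mulr1 mulr0n addr0; exact: mulr1n.
by rewrite bonnet subrK natr1 mulnS; exact: scaler_nat.
Qed.

Lemma functional_Xlegendre k :
  L ('X * P k) = k%:R / (2 * k%:R + 1) * pred_term (fun i => L (P i)) k
    + (k%:R + 1) / (2 * k%:R + 1) * L (P k.+1).
Proof.
rewrite Xlegendre poly_linearZ linL (poly_linearZ k%:R (if k is i.+1 then P i else 0)) fmorphV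
  -double_plus1CE !rmorph_nat.
have -> : L (if k is i.+1 then P i else 0) = pred_term (fun i => L (P i)) k.
  by case: k => [|k] //=; rewrite poly_linear0.
by rewrite -natr1; ring.
Qed.

End functional.

Lemma Rintegral_deriv p (a b : R) : a <= b ->
  \int[mu]_(t in `[a, b]) (p^`()).[t] = p.[b] - p.[a].
Proof.
move=> ab; apply: (@Rintegral_FTC_except _ _ (horner p) a b a) => //.
- by apply: continuous_integrable; exact: continuous_horner.
- exact: continuous_horner.
- by move=> t _; exact: continuous_horner.
Qed.

Lemma poly_integral_deriv p : poly_integral (p^`()) = p.[1] - p.[-1].
Proof. by apply: Rintegral_deriv; lra. Qed.

Lemma poly_integral_legendre k : poly_integral (P k) = if k == 0%N then 2 else 0.
Proof.
rewrite -deriv_legendre_prim poly_integral_deriv; case: k => [|k];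
  first by rewrite !hornerX /=; lra.
by rewrite legendre_prim_at1 legendre_prim_atN1 subrr.
Qed.

Lemma poly_integral_legendre_prim k : (poly_integral (Q k))%:C = if k == 1%N then - (2 / 3)
  else 0 :> R[i].
Proof.
rewrite (functional_legendre_prim poly_integral_linear) poly_integral_legendre /=.
case: k => [|[|k]] /=; first by rewrite subr0 mul0r.
  by rewrite poly_integral_legendre /= rmorph0 (rmorph_nat _ 2); field.
by rewrite poly_integral_legendre /= subr0 mul0r.
Qed.

Lemma legendre_prim0_at1 : (Q 0).[1] = 1. Proof. exact: hornerX. Qed.
Lemma legendre_prim0_atN1 : (Q 0).[-1] = -1. Proof. exact: hornerX. Qed.

Lemma zlog_hmoment_legendre k w : zlog_hmoment (P k) w =
  (log_hmoment (P k.+1) w - pred_term (fun i => log_hmoment (P i) w) k) / (2 * k%:R + 1) +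
    lambda k w.
Proof.
rewrite -(functional_legendre_prim (log_hmoment_linear w)) /zlog_hmoment
  -{1}(deriv_legendre_prim R k).
rewrite zlog_by_parts_h poly_integral_legendre_prim.
case: k => [|k] /=.
  rewrite legendre_prim0_at1 legendre_prim0_atN1 rmorphN rmorph1 /zlog; ring.
rewrite -/(Q k.+1) legendre_prim_at1 legendre_prim_atN1 rmorph0.
by case: k => [|k] /=; ring.
Qed.

Lemma zlog_vmoment_legendre j w : zlog_vmoment (P j) w =
  'i%C * ((log_vmoment (P j.+1) w - pred_term (fun i => log_vmoment (P i) w) j) /
    (2 * j%:R + 1)) + Defs.mu j w.
Proof.
rewrite -(functional_legendre_prim (log_vmoment_linear w)) /zlog_vmoment
  -{1}(deriv_legendre_prim R j).
rewrite zlog_by_parts_v poly_integral_legendre_prim.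
have -> : cut_jump (Q j) w = - mu_n j w.
  rewrite /cut_jump /mu_n; case: ifP => _; last by rewrite oppr0.
  by rewrite ultraspherical_mhalfE -mulrN -rmorphN; congr (_ * _%:C); ring.
rewrite /Defs.mu; case: j => [|j] /=.
  rewrite legendre_prim0_at1 legendre_prim0_atN1 rmorphN rmorph1 /zlog /zlog_minus; ring.
rewrite -/(Q j.+1) legendre_prim_at1 legendre_prim_atN1 rmorph0.
by case: j => [|j] /=; ring.
Qed.

Lemma ramp_moment_right p (x : R) : 1 <= x -> ramp_moment p x = 0.
Proof.
move=> x1; transitivity (\int[mu]_(s in I) (cst 0 s)); last by rewrite Rintegral_cst //= mul0r.
apply: eq_Rintegral => s; rewrite inE /= in_itv/= => /andP[_ s1].
by rewrite max_r ?mul0r // subr_le0 (le_trans s1).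
Qed.

Lemma ramp_moment_left p (x : R) : x <= -1 ->
  ramp_moment p x = poly_integral ('X * p) - x * poly_integral p.
Proof.
move=> x1; rewrite /ramp_moment /poly_integral -RintegralZl //; last exact: integrable_horner.
rewrite -RintegralB //; last 2 first.
- exact: integrable_horner.
- by apply: rintegrableZ => //; exact: integrable_horner.
apply: eq_Rintegral => s; rewrite inE /= in_itv/= => /andP[s1 _].
by rewrite max_l ?subr_ge0 1?(le_trans x1) // hornerM hornerX mulrBl.
Qed.

(** The polynomial [(X - x) S' - S] is a primitive of [(X - x) S'']. *)
Lemma ramp_moment_mid (S : {poly R}) (x : R) : -1 <= x <= 1 ->
  ramp_moment (S^`()^`()) x = (1 - x) * (S^`()).[1] - S.[1] + S.[x].
Proof.
move=> /andP[x1 x2]; rewrite /ramp_moment.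
have i1 : mu.-integrable I (EFin \o (fun s => Num.max (s - x) 0 * (S^`()^`()).[s])).
  by case: (cintegrable_ramp (S^`()^`()) x).
rewrite (@Rintegral_split _ _ _ x) ?x1 //.
rewrite (_ : \int[mu]_(t in `[-1, x]) _ = \int[mu]_(t in `[-1, x]) (cst 0 t)); last first.
  apply: eq_Rintegral => s; rewrite inE /= in_itv/= => /andP[_ sx].
  by rewrite max_r ?mul0r // subr_le0.
rewrite Rintegral_cst //= mul0r add0r.
pose F := ('X - x%:P) * S^`() - S.
transitivity (\int[mu]_(t in `[x, 1]) (F^`()).[t]).
  apply: eq_Rintegral => s; rewrite inE /= in_itv/= => /andP[sx _].
  rewrite max_l ?subr_ge0 // /F !(derivD, derivM, derivN, derivX, derivC) subr0 mul1r.
  by rewrite addrAC subrr add0r hornerM hornerD hornerN hornerX hornerC.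
rewrite Rintegral_deriv // /F !(hornerD, hornerN, hornerM, hornerX, hornerC); ring.
Qed.

Lemma poly_integral_Xlegendre k : poly_integral ('X * P k) = if k == 1%N then 2 / 3 else 0.
Proof.
apply: (@complexI R); rewrite (functional_Xlegendre poly_integral_linear) /=
  !poly_integral_legendre.
case: k => [|[|k]] /=; rewrite ?poly_integral_legendre /= ?rmorph0.
- by rewrite mul0r mul0r mulr0 addr0.
- by rewrite fmorph_div !rmorph_nat; field.
- by rewrite !mulr0 addr0.
Qed.

Lemma ramp_moment_legendre k (x : R) : -1 <= x <= 1 ->
  ramp_moment (P k) x = ultraspherical (- (3 / 2)) k.+2 x / 3
    - (k == 0%N)%:R * x + (k == 1%N)%:R / 3.
Proof.
move=> x1; case: k => [|k].
  rewrite ultraspherical_m3half0.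
  have d1 : ((2^-1 *: 'X^2 : {poly R})^`()) = 'X.
    by rewrite derivZ derivXn /= expr1 -scalerMnr scalerMnl -[_ *+ _]mulr_natr mulVf ?scale1r.
  have := ramp_moment_mid (2^-1 *: 'X^2) x1; rewrite d1 derivX -(legendre0 R) => ->.
  by rewrite !hornerZ !hornerXn hornerX /= ; field.
rewrite ultraspherical_m3halfE -(deriv_legendre_prim R k.+1) -deriv_legendre_prim2
  ramp_moment_mid //.
rewrite deriv_legendre_prim2 legendre_prim_at1 mulr0 sub0r.
case: k => [|k]; last by rewrite legendre_prim2_at1 /=; ring.
by rewrite horner_legendre_prim2 legendre_prim_at1 legendre_prim0_at1 /=; field.
Qed.

End LinearFunctionals.

(** * The two recurrences *)

Section Recurrences.
Variable R : realType.
Local Notation P := (legendre R).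
Local Notation Q := (legendre_prim R).
Implicit Types (z : R[i]) (k j : nat).
Local Notation Re := (@complex.Re R).
Local Notation Im := (@complex.Im R).

Lemma zlog_moment2_F1 z k j : zlog_moment2 (P k) (P j) z =
  (log_moment2 (P k.+1) (P j) z - pred_term (fun i => log_moment2 (P i) (P j) z) k) /
    (2 * k%:R + 1) + F1 k j z.
Proof.
rewrite -(functional_legendre_prim (log_moment2_linear1 (P j) z) k)
  -{1}(deriv_legendre_prim R k).
rewrite zlog_moment2_deriv_h !zlog_vmoment_legendre poly_integral_legendre_prim
  poly_integral_legendre /F1.
case: k => [|k].
  rewrite legendre_prim0_at1 legendre_prim0_atN1 rmorphN rmorph1 mul0r addr0 mulN1r opprK mul1r
    /=.
  have alg (L m1 m2 p1 p2 d u1 u2 : R[i]) :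
    L + ('i%C * ((m1 - p1) / d) + u1) + ('i%C * ((m2 - p2) / d) + u2) =
    L + ('i%C * ((m1 + m2 - p1 - p2) / d) + u1 + u2) by ring.
  exact: alg.
rewrite legendre_prim_at1 legendre_prim_atN1 rmorph0.
have alg (L m1 m2 c F : R[i]) : c = F -> L + 0 * m1 - 0 * m2 + c = L + F.
  by move=> ->; ring.
apply: alg; case: k => [|k] /=; last by rewrite mul0r.
case: j => [|j] /=; last by rewrite rmorph0 mulr0.
by rewrite (rmorph_nat _ 2); field.
Qed.

(** Here [beta] is compared with the total jump, case by case on the position
    of [Im z] with respect to [-1] and [1].  On the lines [Im z = 1] and
    [Im z = -1] the two agree for [j > 0] because the primitive vanishes there,
    and for [j = 0] off the exceptional points. *)
Lemma betaE z k j : ~~ exceptional k j z ->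
  beta k j z = - (2 * 'i%C * (pi * ((Im z == -1)%R%:R * (Q j).[-1]
    + (-1 < Im z < 1)%R%:R * (Q j).[Im z]))%:C
    * (ramp_moment (P k) (Re z))%:C).
Proof.
case: z => x y; rewrite /exceptional /beta [Re _]/= [Im _]/= ultraspherical_mhalfE => nexc.
set B := (if _ then _ else _); set W := _ + _ * (Q j).[y].
suff H : (Q j).[y] * B = W * ramp_moment (P k) x.
  transitivity (- (2 * 'i%C * pi%:C * ((Q j).[y] * B)%:C)).
    by rewrite !(rmorphM, rmorphN) /=; ring.
  by rewrite H !rmorphM /=; ring.
rewrite {}/W {}/B /Omega in_setX !mem_setE !in_itv/=.
have rl (x1 : x < -1) : ramp_moment (P k) x = - (2 * x * (k == 0%N)%:R) + 2 * (k == 1%N)%:R / 3.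
  rewrite ramp_moment_left 1?ltW // poly_integral_legendre poly_integral_Xlegendre.
  by case: k {nexc} => [|[|k]] /=; field.
have [y1|y1|y1] := ltgtP y (-1).
- by rewrite /= ?andbF !mul0r addr0 mul0r mulr0.
- rewrite /= mul0r add0r; have [y2|y2|y2] := ltgtP y 1; rewrite /= ?andbT ?andbF ?mul1r.
  + have [/andP[x1 x2]|xout] := boolP (-1 <= x <= 1).
      by rewrite ramp_moment_legendre // x1.
    have [x1|x1] := ltP x (-1); first by rewrite rl.
    have x2 : 1 <= x by move: xout; rewrite x1 /= -ltNge => /ltW.
    by rewrite ramp_moment_right.
  + by rewrite !mul0r mulr0.
  + rewrite !mul0r; case: j nexc => [|j] nexc; last by rewrite y2 legendre_prim_at1 mul0r.
    have [/andP[x1 x2]|_] := boolP (-1 <= x <= 1); last by rewrite mulr0.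
    move: nexc; rewrite y2 !eqxx x1 /= negb_or -leNgt => /andP[x3 _].
    by rewrite -ramp_moment_legendre ?x1 // ramp_moment_right // mulr0.
- rewrite y1 /= mul1r mul0r addr0.
  case: j nexc => [|j] nexc; last by rewrite legendre_prim_atN1 !mul0r.
  have m1 : (-1 <= 1 :> R) = true by lra.
  rewrite m1 ?andbT.
  have [/andP[x1 x2]|xout] := boolP (-1 <= x <= 1).
    by rewrite ramp_moment_legendre // x1.
  rewrite andbF mulr0; have [x1|x1] := ltP x (-1); last first.
    have x2 : 1 <= x by move: xout; rewrite x1 /= -ltNge => /ltW.
    by rewrite ramp_moment_right ?mulr0.
  move: nexc; rewrite y1 x1 !eqxx /= => /norP[_]; rewrite andbT -leqNgt => k2.
  by rewrite rl //; case: k k2 {rl} => [|[|k]] //= _; rewrite !mulr0 oppr0 add0r mul0r mulr0.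
Qed.

Lemma zlog_moment2_F2 z k j : ~~ exceptional k j z -> zlog_moment2 (P k) (P j) z =
  'i%C * ((log_moment2 (P k) (P j.+1) z - pred_term (fun i => log_moment2 (P k) (P i) z) j) /
    (2 * j%:R + 1)) + F2 k j z.
Proof.
move=> nexc; have bE := betaE nexc.
rewrite -(functional_legendre_prim (log_moment2_linear2 (P k) z) j)
  -{1}(deriv_legendre_prim R j).
rewrite zlog_moment2_deriv_v !zlog_hmoment_legendre poly_integral_legendre_prim
  poly_integral_legendre /F2.
case: j nexc bE => [|j] nexc bE.
  rewrite legendre_prim0_at1 legendre_prim0_atN1 rmorphN rmorph1 mulr0 mul0r addr0 mulN1r opprK
    mul1r eqxx.
  have alg (L m1 m2 p1 p2 d u1 u2 b b' : R[i]) : b = - b' ->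
    L + ((m1 - p1) / d + u1) + ((m2 - p2) / d + u2) - b' =
    L + ((m1 + m2 - p1 - p2) / d + u1 + u2 + b) by move=> ->; ring.
  apply: alg; rewrite bE legendre_prim0_atN1; reflexivity.
rewrite legendre_prim_at1 legendre_prim_atN1 rmorph0 !mul0r subr0 addr0.
have alg (L c b b' : R[i]) : b = - b' -> L - b' + c = L + (c + b) by move=> ->; ring.
transitivity ('i%C * log_moment2 (P k) (Q j.+1) z +
  ('i%C * (if j.+1 == 1%N then - (2 / 3) else 0) *
  ((if k == 0%N then 2 else 0 : R)%:C) + beta k j.+1 z)).
  by apply: alg; rewrite bE legendre_prim_atN1.
congr (_ + _); case: j {nexc bE} => [|j]; case: k => [|k] /=.
- by congr (_ + _); rewrite (rmorph_nat _ 2); field.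
- by rewrite rmorph0 mulr0 add0r.
- by rewrite -mulrA mul0r mulr0 add0r.
- by rewrite -mulrA mul0r mulr0 add0r.
Qed.

End Recurrences.

Theorem theorem3p3 (R : realType) (z : R[i]) (k j : nat) :
  (z * Ldouble k j z =
     (k%:R - 1) / (2 * k%:R + 1) * pred_term (fun k' => Ldouble k' j z) k
   + (k%:R + 2) / (2 * k%:R + 1) * Ldouble k.+1 j z
   + 'i%C * (j%:R / (2 * j%:R + 1) * pred_term (fun j' => Ldouble k j' z) j
           + (j%:R + 1) / (2 * j%:R + 1) * Ldouble k j.+1 z)
   + F1 k j z)
  /\
  (~~ exceptional k j z ->
   z * Ldouble k j z =
     k%:R / (2 * k%:R + 1) * pred_term (fun k' => Ldouble k' j z) k
   + (k%:R + 1) / (2 * k%:R + 1) * Ldouble k.+1 j z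
   + 'i%C * ((j%:R - 1) / (2 * j%:R + 1) * pred_term (fun j' => Ldouble k j' z) j
           + (j%:R + 2) / (2 * j%:R + 1) * Ldouble k j.+1 z)
   + F2 k j z).
Proof.
have E := log_moment2_mul_z z (legendre R k) (legendre R j).
rewrite (functional_Xlegendre (log_moment2_linear1 (legendre R j) z) k) in E.
rewrite (functional_Xlegendre (log_moment2_linear2 (legendre R k) z) j) in E.
have kn0 := double_plus1C R k; have jn0 := double_plus1C R j.
split=> [|nexc]; (etransitivity; first exact: E).
  rewrite zlog_moment2_F1.
  have alg (n a b J F : R[i]) : 2 * n + 1 != 0 ->
    n / (2 * n + 1) * a + (n + 1) / (2 * n + 1) * b + J + ((b - a) / (2 * n + 1) + F) =
    (n - 1) / (2 * n + 1) * a + (n + 2) / (2 * n + 1) * b + J + F by move=> ?; field.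
  exact: alg kn0.
rewrite (zlog_moment2_F2 nexc).
have alg (n a b J F : R[i]) : 2 * n + 1 != 0 ->
  J + 'i%C * (n / (2 * n + 1) * a + (n + 1) / (2 * n + 1) * b) + ('i%C * ((b - a) / (2 * n + 1)) + F) =
  J + 'i%C * ((n - 1) / (2 * n + 1) * a + (n + 2) / (2 * n + 1) * b) + F by move=> ?; field.
exact: alg jn0.
Qed.
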